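(* Let $\mathbb{A}=[A_{i,j}]_{1\le i,j\le m}$ be a Hermitian $mn\times mn$ complex matrix partitioned in blocks $A_{i,j}$ of the same size $n\times n$, and let $f:[0,\infty)\to[0,\infty)$ be concave and e-convex. Then, for every symmetric norm $\|\cdot\|$, $$ \left\|\,f(|\mathbb{A}|)\,\right\|\le\left\|\,\sum_{i,j=1}^m f(|A_{i,j}|)\,\right\|. $$
   Context: For a complex matrix $X$, $|X|=(X^*X)^{1/2}$. For a positive semi-definite $P$, $f(P)$ is defined by the functional calculus. A function $f$ on $[0,\infty)$ is called e-convex if $t\mapsto f(e^t)$ is convex on $(-\infty,\infty)$. A symmetric (or unitarily invariant) norm is a norm on complex matrices satisfying $\|X\|=\|UXV\|$ for all $X$ and all unitaries $U,V$. Here the symmetric norm is a norm on the $mn\times mn$ matrices, and an $n\times n$ matrix $Y$ is identified with $\begin{pmatrix}Y&0\\0&0\end{pmatrix}$ (padding with zeros) when its norm is taken. *)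

(* Defs.v *)
From HB Require Import structures.
From mathcomp Require Import all_boot all_order all_algebra.
From mathcomp Require Export complex.
From mathcomp Require Export classical_sets set_interval reals sequences convex.

Set Implicit Arguments.
Unset Strict Implicit.
Unset Printing Implicit Defensive.

Import Order.TTheory GRing.Theory Num.Theory.
Local Open Scope ring_scope.
Local Open Scope sesquilinear_scope.
Local Open Scope complex_scope.

(* Functional calculus f(P) for a Hermitian P.  With P = U^-1 diag(d) U the
   library's unitary diagonalization, d has real entries, so taking real parts
   loses nothing; the result does not depend on the diagonalization chosen.
   For a P that is not normal the value is meaningless. *)
Definition fun_mx (R : realType) (k : nat) (f : R -> R) (P : 'M[R[i]]_k) :
    'M[R[i]]_k :=
  invmx (spectralmx P)
    *m diag_mx (map_mx (fun z : R[i] => (f (complex.Re z))%:C) (spectral_diag P))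
    *m spectralmx P.

Definition abs_mx (R : realType) (k : nat) (X : 'M[R[i]]_k) : 'M[R[i]]_k :=
  fun_mx (@Num.sqrt R) (X^t* *m X).

(* The domain of f is [0, +oo); the values of f : R -> R at negative reals are
   unconstrained and never used, since they are only taken on spectra of
   positive semi-definite matrices. *)
Definition concave_on_nonneg (R : realType) (f : R -> R) : Prop :=
  @convex_function R R^o `[0, +oo[%classic (fun x => - f x).

Definition e_convex (R : realType) (f : R -> R) : Prop :=
  @convex_function R R^o setT (fun t => f (expR t)).

(* Nonnegativity is not listed: it follows from the first two fields. *)
Record symmetric_norm (R : realType) (k : nat) (N : 'M[R[i]]_k -> R) : Prop := {
  symnormD : forall X Y, N (X + Y) <= N X + N Y;
  symnormZ : forall a X, N (a *: X) = ComplexField.Normc.normc a * N X;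
  symnorm0_eq0 : forall X, N X = 0 -> X = 0;
  symnorm_unitary : forall U X V, U \is unitarymx -> V \is unitarymx ->
    N (U *m X *m V) = N X
}.

(* Y as the top-left block of an m * n by m * n matrix, zero elsewhere. *)
Definition pad_mx (R : realType) (m n : nat) (Y : 'M[R[i]]_n) :
    'M[R[i]]_(\sum_(i < m) n) :=
  \mxblock_(i < m, j < m)
    (if (i == 0%N :> nat) && (j == 0%N :> nat) then Y else 0).

(* Main.v *)
Require Import Defs.
From mathcomp Require Import all_boot all_order all_algebra.
From mathcomp Require Import interval_inference boolp exp perm.
From mathcomp Require Import lra ring.

(** With D = diag_j (sum_i |A_ij|) one has -D <= A <= D, because each block
    satisfies |Re (x A_ij y^* )| <= (x |A_ij^*| x^* + y |A_ij| y^* ) / 2.  Hence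
    the singular values of A are weakly log-majorized by the eigenvalues of D,
    and e-convexity turns this into weak majorization of f(|A|) by f(D).

    To compare f(D) with the f(|A_ij|), test against the spectral projection E
    of D onto its top k eigenvectors: each spectral piece p v v^* of some |A_ij|
    lies below D, and concavity together with Chebyshev's sum inequality bounds
    its share in tr (E f(D)) by f(p) <v, E v>.  The blocks of E live in the same
    n-dimensional space, so the projection onto the sum of their ranges, whose
    rank is at most k, dominates all of them, and the Ky Fan maximum principle
    for sum_ij f(|A_ij|) applies.  Ky Fan dominance concludes. *)

Set Implicit Arguments.
Unset Strict Implicit.
Unset Printing Implicit Defensive.

Import Order.TTheory GRing.Theory Num.Theory.
Local Open Scope ring_scope.
Local Open Scope sesquilinear_scope.
Local Open Scope complex_scope.

(** The bounds -D <= A <= D do not make each singular value of A at most the matching eigenvalue of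
    D: with A = [[0,1],[1,0]] and D = diag(2, 1/2) they hold, yet the second singular value 1
    exceeds 1/2. Only products of leading values compare, because on the span of k eigenvectors of A
    the inequality passes to determinants. E-convexity is what makes products enough: f composed
    with exp is convex, and it is nondecreasing because a nonnegative concave function on the
    half-line is.

    The comparison of f(D) with the sum of the f(|A_ij|) rests on concavity alone. Its obstacle is a
    change of size: f(D) is a direct sum of m blocks, while the target is a single n x n sum.
    Testing on eigenvectors of D settles both matters at once, since each of them lies in one block
    and can be moved to the common n-dimensional space. *)

(** * Concave functions, convex functions and Jensen's inequality *)

Lemma convex_functionP (R : realType) (D : set R) (f : R -> R) :
  @convex_function R R^o D f ->
  forall c x y, 0 <= c <= 1 -> D x -> D y ->
    f (c * x + (1 - c) * y) <= c * f x + (1 - c) * f y.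
Proof.
move=> fD c x y /andP[c0 c1] Dx Dy.
have := fD (Itv01 c0 c1) x y (mem_set Dx) (mem_set Dy).
by rewrite !convRE.
Qed.

Lemma concave_nonnegP (R : realType) (f : R -> R) : concave_on_nonneg f ->
  forall c x y, 0 <= c <= 1 -> 0 <= x -> 0 <= y ->
    c * f x + (1 - c) * f y <= f (c * x + (1 - c) * y).
Proof.
move=> cf c x y c01 x0 y0.
have := convex_functionP cf c01 (x := x) (y := y).
rewrite /= !in_itv /= !andbT => /(_ x0 y0); lra.
Qed.

(* A chord of negative slope would make f negative far to the right. *)
Lemma concave_ge0_homo (R : realType) (f : R -> R) :
  (forall x, 0 <= x -> 0 <= f x) -> concave_on_nonneg f ->
  forall s t, 0 <= s -> s <= t -> f s <= f t.
Proof.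
move=> f0 /concave_nonnegP cf s t s0 st; rewrite leNgt; apply/negP => fts.
have {st} st : s < t.
  by rewrite lt_neqAle st andbT; apply: contraTneq fts => ->; rewrite ltxx.
have ft0 : 0 <= f t by apply: f0; lra.
have fs0 : 0 < f s by lra.
(* With this weight (1 - e) f(s) is the midpoint of f(s) and f(t), and [u] is the point with t = (1
   - e) s + e u. As f(u) >= 0, concavity puts f(t) above that midpoint, hence above itself. *)
pose e := (f s - f t) / (2 * f s).
have e0 : 0 < e by rewrite divr_gt0 //; lra.
have e1 : e <= 1 by rewrite ler_pdivrMr; lra.
pose u := s + (t - s) / e.
have u0 : 0 <= u by rewrite addr_ge0 // divr_ge0 //; lra.
have := cf (1 - e) s u _ s0 u0.
have -> : (1 - e) * s + (1 - (1 - e)) * u = t by rewrite /u; field; lra.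
have := f0 u u0 => fu0.
have e01 : 0 <= 1 - e <= 1 by lra.
move=> /(_ e01).
have : (1 - e) * f s = f s - (f s - f t) / 2 by rewrite /e; field; lra.
have : 0 <= e * f u by rewrite mulr_ge0 // ltW.
lra.
Qed.

(** Total weight below 1 is allowed because the missing mass can sit at 0, where f is nonnegative.
    The induction splits off one point and renormalizes the others by 1 - w_i. *)
Lemma concave_jensen (R : realType) (f : R -> R) (I : Type) (r : seq I)
    (P : pred I) (w t : I -> R) :
  (forall x, 0 <= x -> 0 <= f x) -> concave_on_nonneg f ->
  (forall i, P i -> 0 <= w i) -> (forall i, P i -> 0 <= t i) ->
  \sum_(i <- r | P i) w i <= 1 ->
  \sum_(i <- r | P i) w i * f (t i) <= f (\sum_(i <- r | P i) w i * t i).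
Proof.
move=> f0 cf; have cf' := concave_nonnegP cf.
move=> w0 t0.
have S0 : 0 <= \sum_(i <- r | P i) w i by apply: sumr_ge0.
elim: r w w0 S0 => [|i r IH] w w0 S0; first by rewrite !big_nil f0.
rewrite !big_cons; case: ifPn => Pi; last first.
  by move: S0; rewrite big_cons (negPf Pi); exact: IH.
set W := \sum_(j <- r | P j) w j.
have W0 : 0 <= W by apply: sumr_ge0.
have wi0 := w0 _ Pi; have ti0 := t0 _ Pi.
move=> W1.
(* Renormalization is impossible when w_i = 1, but then all other weights vanish. *)
have [wi1|wi1] := eqVneq (w i) 1.
  have W00 : W = 0 by lra.
  have wj0 : forall g : I -> R, \sum_(j <- r | P j) w j * g j = 0.
    move=> g; move: W00; rewrite /W.
    elim: (r) => [|j s IHs]; first by rewrite !big_nil.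
    rewrite !big_cons; case: ifP => // Pj /eqP.
    rewrite paddr_eq0 ?sumr_ge0 ?w0 // => /andP[/eqP-> /eqP /IHs->].
    by rewrite mul0r addr0.
  by rewrite !wj0 wi1 !mul1r !addr0.
have wi1' : 0 < 1 - w i by lra.
have := IH (fun j => w j / (1 - w i)).
have sc g : \sum_(j <- r | P j) w j / (1 - w i) * g j =
            (\sum_(j <- r | P j) w j * g j) / (1 - w i).
  by rewrite mulr_suml; apply: eq_bigr => j _; rewrite mulrAC.
rewrite !sc -mulr_suml -/W.
set F := \sum_(j <- r | P j) w j * f (t j); set T := \sum_(j <- r | P j) _.
have wj0 j : P j -> 0 <= w j / (1 - w i).
  by move=> Pj; rewrite divr_ge0 ?w0 // ltW.
have W0' : 0 <= W / (1 - w i) by rewrite divr_ge0 // ltW.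
have W1' : W / (1 - w i) <= 1 by rewrite ler_pdivrMr //; lra.
move=> /(_ wj0 W0' W1') FT.
have T0 : 0 <= T / (1 - w i).
  rewrite divr_ge0 ?(ltW wi1') //.
  by apply: sumr_ge0 => j Pj; rewrite mulr_ge0 ?w0 ?t0.
have wi01 : 0 <= w i <= 1 by lra.
have := cf' (w i) (t i) (T / (1 - w i)) wi01 ti0 T0.
have -> : (1 - w i) * (T / (1 - w i)) = T.
  by rewrite mulrC divfK // gt_eqF.
apply: le_trans.
rewrite lerD2l.
by rewrite mulrC -ler_pdivrMr.
Qed.

(** * Majorization of real vectors *)

Lemma sum_lt_mulrb (R : pzRingType) (K k : nat) (i : 'I_K) (a : R) :
  \sum_(s < K | (s < k)%N) a * (s == i)%:R = a * (i < k)%:R.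
Proof.
rewrite big_mkcond (bigD1 i) //= eqxx big1 => [|s si]; last first.
  by rewrite (negPf si) mulr0 if_same.
by rewrite addr0; case: ifP => _; rewrite ?mulr1 ?mulr0.
Qed.

(* Hardy, Littlewood and Polya: y is carried to x by T-transforms between a
   surplus coordinate i and the first deficient coordinate l > i, each of which
   makes one more coordinate agree with x, and then by lowering coordinates. *)
Lemma weak_majorization_le (R : realFieldType) (K : nat) (Phi : 'rV[R]_K -> R)
    (x y : 'rV[R]_K) :
  (forall (z : 'rV[R]_K) (i l : 'I_K) (c : R), 0 <= c <= 1 ->
    Phi (\row_s ((1 - c) * z 0 s + c * z 0 (tperm i l s))) <= Phi z) ->
  (forall (z : 'rV[R]_K) l, x 0 l <= z 0 l ->
    Phi (\row_s (if s == l then x 0 l else z 0 s)) <= Phi z) ->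
  (forall i j : 'I_K, (i <= j)%N -> x 0 j <= x 0 i) ->
  (forall k, (k <= K)%N ->
    \sum_(s < K | (s < k)%N) x 0 s <= \sum_(s < K | (s < k)%N) y 0 s) ->
  Phi x <= Phi y.
Proof.
move=> PhiT Phil xdec.
have [n] := ubnP #|[pred s | x 0 s != y 0 s]|.
elim: n y => // n IH y; rewrite ltnS => nP maj.
have [xley|] := boolP [forall s, x 0 s <= y 0 s].
  have [l xl|eq_xy] := pickP [pred s | x 0 s != y 0 s]; last first.
    suff -> : x = y by [].
    by apply/rowP => s; apply/eqP; have /= /negbFE := eq_xy s.
  apply: le_trans (Phil y l (forallP xley l)).
  apply: IH; last first.
    move=> k _; apply: ler_sum => s _; rewrite mxE.
    by case: eqP => [->//|_]; apply: (forallP xley s).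
  apply: leq_trans nP; apply: proper_card; apply/properP; split.
    apply/subsetP => s; rewrite !inE mxE.
    by case: (eqVneq s l) => // ->; rewrite eqxx.
  by exists l => //; rewrite !inE mxE !eqxx.
rewrite negb_forall => /existsP[l0]; rewrite -ltNge => l0P.
have [l lP lmin] : exists2 l : 'I_K, y 0 l < x 0 l &
    forall s : 'I_K, (s < l)%N -> x 0 s <= y 0 s.
  case: (arg_minnP (fun s : 'I_K => val s) (P := fun s => y 0 s < x 0 s) l0P).
  move=> l lP lmin; exists l => // s sl; rewrite leNgt; apply/negP => /lmin.
  by rewrite /= leqNgt sl.
have [i il iP] : exists2 i : 'I_K, (i < l)%N & x 0 i < y 0 i.
  have [/existsP[i /andP[]]|] :=
    boolP [exists i : 'I_K, (i < l)%N && (x 0 i < y 0 i)]; first by exists i.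
  rewrite negb_exists => /forallP allge.
  have := maj l.+1 (ltn_ord l); rewrite leNgt => /negP[].
  rewrite (bigD1 l) //= [X in _ < X](bigD1 l) //=.
  rewrite ltr_leD // ler_sum // => s /andP[]; rewrite ltnS leq_eqVlt.
  move=> /orP[/eqP/val_inj-> /eqP//|sl _].
  by move: (allge s); rewrite sl -leNgt.
have neq_il : i != l by apply: contraTneq il => ->; rewrite ltnn.
(* The largest amount that can move from i to l without overshooting x at either place; the
   coordinate attaining the minimum then agrees with x. The fraction [c] below is at most 1 because
   y_l < x_l <= x_i < y_i. *)
pose del := Num.min (y 0 i - x 0 i) (x 0 l - y 0 l).
have xli : x 0 l <= x 0 i by apply: xdec; apply: ltnW.
have del0 : 0 < del by rewrite lt_min !subr_gt0 iP lP.
have deli : del <= y 0 i - x 0 i by rewrite ge_min lexx.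
have dell : del <= x 0 l - y 0 l by rewrite ge_min lexx orbT.
have gap : 0 < y 0 i - y 0 l by lra.
pose c := del / (y 0 i - y 0 l).
have c01 : 0 <= c <= 1.
  by rewrite divr_ge0 ?(ltW del0) ?(ltW gap) //= ler_pdivrMr //; lra.
have cE : c * (y 0 i - y 0 l) = del by rewrite divfK // gt_eqF.
pose y' := \row_s ((1 - c) * y 0 s + c * y 0 (tperm i l s)).
have y'E s : y' 0 s = y 0 s + (- del) * (s == i)%:R + del * (s == l)%:R.
  rewrite mxE -cE; case: tpermP => [->|->|/eqP/negPf-> /eqP/negPf->].
  - by rewrite eqxx (negPf neq_il) mulr1 mulr0; ring.
  - by rewrite eqxx eq_sym (negPf neq_il) mulr1 mulr0; ring.
  - by rewrite !mulr0; ring.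
have y'i : y' 0 i = y 0 i - del.
  by rewrite y'E eqxx (negPf neq_il) mulr1 mulr0; ring.
have y'l : y' 0 l = y 0 l + del.
  by rewrite y'E eqxx eq_sym (negPf neq_il) mulr1 mulr0; ring.
have y'ne s : s != i -> s != l -> y' 0 s = y 0 s.
  by rewrite y'E => /negPf-> /negPf->; rewrite !mulr0 !addr0.
apply: le_trans (PhiT y i l c c01); rewrite -/y'.
apply: IH.
  apply: leq_trans nP; apply: proper_card; apply/properP; split.
    apply/subsetP => s; rewrite !inE.
    have [->|si] := eqVneq s i; first by rewrite (lt_eqF iP).
    have [->|sl] := eqVneq s l; first by rewrite (gt_eqF lP).
    by rewrite y'ne.
  have [dE|dE] := leP (y 0 i - x 0 i) (x 0 l - y 0 l).
    exists i; rewrite !inE ?(lt_eqF iP) // y'i /del (min_idPl dE).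
    by rewrite opprB addrC subrK eqxx.
  exists l; rewrite !inE ?(gt_eqF lP) // y'l /del (min_idPr (ltW dE)).
  by rewrite addrC subrK eqxx.
move=> k kK; under [X in _ <= X]eq_bigr do rewrite y'E.
rewrite !big_split /= !sum_lt_mulrb.
have [ik|ki] := ltnP i k; last first.
  by rewrite ltnNge (leq_trans ki (ltnW il)) /= !mulr0 !addr0 maj.
have [lk|kl] := ltnP l k; first by rewrite !mulr1 subrK maj.
(* Only for i < k <= l does the partial sum drop. There x <= y termwise by minimality of l, and y_i
   - del is still at least x_i. *)
rewrite mulr1 mulr0 addr0.
rewrite (bigD1 i) //= [X in _ <= X - _](bigD1 i) //=.
have : \sum_(s < K | (s < k)%N && (s != i)) x 0 s <=
    \sum_(s < K | (s < k)%N && (s != i)) y 0 s.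
  by apply: ler_sum => s /andP[sk _]; apply: lmin; apply: leq_trans kl.
by lra.
Qed.

Lemma perm_nonincreasing (R : realDomainType) (K : nat) (F : 'I_K -> R) :
  exists s : 'S_K, forall i j : 'I_K, (i <= j)%N -> F (s j) <= F (s i).
Proof.
pose t := [tuple F i | i < K].
have /tuple_permP[s sE] : perm_eq (sort (fun a b : R => b <= a) t) t.
  by rewrite perm_sort.
exists s => i j ij.
have srt : sorted (fun a b : R => b <= a) (sort (fun a b : R => b <= a) t).
  by apply: sort_sorted => a b; apply: le_total.
have szt : size (sort (fun a b : R => b <= a) t) = K.
  by rewrite size_sort size_tuple.
have nthE (a : 'I_K) : nth 0 (sort (fun a b : R => b <= a) t) a = F (s a).
  by rewrite sE -tnth_nth !tnth_mktuple.
rewrite -!nthE; apply: (sorted_leq_nth _ _ _ srt); rewrite ?inE ?szt //.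
by move=> a b d ba ac; exact: le_trans ac ba.
Qed.

(** The scalar core of Ky Fan's maximum principle: [w] will be the diagonal, in an eigenbasis, of a
    projection of rank at most k. Subtracting the first value [c] outside the top k makes weight 1
    optimal inside and weight 0 outside; the bound on the total weight and c >= 0 restore the
    constant. *)
Lemma sum_weights_le_top (R : realDomainType) (K k : nat) (y w : 'I_K -> R) :
  (forall i j : 'I_K, (i <= j)%N -> y j <= y i) -> (forall i, 0 <= y i) ->
  (forall i, 0 <= w i <= 1) -> \sum_i w i <= k%:R ->
  \sum_i w i * y i <= \sum_(i < K | (i < k)%N) y i.
Proof.
move=> ydec y0 w01 wk.
have [Kk|kK] := leqP K k.
  rewrite [X in _ <= X](eq_bigl xpredT) => [|i]; last first.
    by rewrite (leq_trans (ltn_ord i) Kk).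
  apply: ler_sum => i _; have /andP[wi0 wi1] := w01 i.
  by rewrite ler_piMl.
pose c := y (Ordinal kK).
have split1 : \sum_i w i * (y i - c) <= \sum_(i < K | (i < k)%N) (y i - c).
  rewrite [X in _ <= X]big_mkcond; apply: ler_sum => i _.
  have /andP[wi0 wi1] := w01 i.
  case: ltnP => ik.
    have : 0 <= y i - c by rewrite subr_ge0; apply: ydec; apply: ltnW.
    by move=> yc; rewrite ler_piMl.
  by rewrite mulr_ge0_le0 // subr_le0; apply: ydec.
have cardk : \sum_(i < K | (i < k)%N) c = c * k%:R.
  by rewrite (big_ord_narrow (ltnW kK)) sumr_const card_ord mulr_natr.
move: split1; rewrite sumrB cardk; under eq_bigr do rewrite mulrBr.
rewrite sumrB -mulr_suml => h.
have : (\sum_i w i) * c <= k%:R * c by rewrite ler_wpM2r ?y0.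
lra.
Qed.

Lemma sum_weights_le_top_perm (R : realDomainType) (K k : nat)
    (y w : 'I_K -> R) (t : 'S_K) :
  (forall i j : 'I_K, (i <= j)%N -> y (t j) <= y (t i)) ->
  (forall i, 0 <= y i) ->
  (forall i, 0 <= w i <= 1) -> \sum_i w i <= k%:R ->
  \sum_i w i * y i <= \sum_(i < K | (i < k)%N) y (t i).
Proof.
move=> ydec y0 w01; rewrite (reindex_inj (@perm_inj _ t)) /= => wk.
rewrite (reindex_inj (@perm_inj _ t)) /=.
exact: (sum_weights_le_top (y := fun i => y (t i)) (w := fun i => w (t i)) ydec
  (fun i => y0 (t i)) (fun i => w01 (t i)) wk).
Qed.

Lemma e_convexP (R : realType) (f : R -> R) : e_convex f ->
  forall c x y, 0 <= c <= 1 ->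
  f (expR (c * x + (1 - c) * y)) <= c * f (expR x) + (1 - c) * f (expR y).
Proof. by move=> cf c x y c01; exact: (convex_functionP cf c01 I I). Qed.

(** Taking logarithms turns the products into weak majorization, to which the convex nondecreasing
    function f(exp) applies. Logarithms need positive entries, so products are compared only on
    prefixes where x is positive; when the last entry of a prefix is 0, induction splits it off,
    with f(0) <= f(d_k). *)
Lemma weak_log_majorization_sum_le (R : realType) (f : R -> R) (K : nat)
    (x d : 'I_K -> R) :
  (forall s t, 0 <= s -> s <= t -> f s <= f t) -> e_convex f ->
  (forall i, 0 <= x i) -> (forall i, 0 <= d i) ->
  (forall i j : 'I_K, (i <= j)%N -> x j <= x i) ->
  (forall k, (k <= K)%N -> (forall i : 'I_K, (i < k)%N -> 0 < x i) ->
    \prod_(i < K | (i < k)%N) x i <= \prod_(i < K | (i < k)%N) d i) ->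
  forall k, (k <= K)%N ->
  \sum_(i < K | (i < k)%N) f (x i) <= \sum_(i < K | (i < k)%N) f (d i).
Proof.
move=> fhomo /e_convexP ef x0 d0 xdec logmaj; elim=> [|k IH] kK.
  by rewrite !big_pred0.
have [xk0|xk] := leP (x (Ordinal kK)) 0.
  have {}xk0 : x (Ordinal kK) = 0 by apply/eqP; rewrite eq_le xk0 x0.
  rewrite (bigD1 (Ordinal kK)) //= [X in _ <= X](bigD1 (Ordinal kK)) //=.
  apply: lerD; first by rewrite xk0; apply: fhomo.
  have E (i : 'I_K) : (i < k.+1)%N && (i != Ordinal kK) = (i < k)%N.
    by rewrite ltnS -(inj_eq val_inj) /= ltn_neqAle andbC.
  by rewrite !(eq_bigl _ _ E) IH // ltnW.
have xpos (i : 'I_k.+1) : 0 < x (widen_ord kK i).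
  by apply: lt_le_trans xk _; apply: xdec; rewrite /= -ltnS.
have xpos' k' (kk : (k' <= k.+1)%N) (i : 'I_K) : (i < k')%N -> 0 < x i.
  move=> ik; have := xpos (Ordinal (leq_trans ik kk)).
  by congr (0 < x _); apply: val_inj.
have lm k' (kk : (k' <= k.+1)%N) := logmaj k' (leq_trans kk kK) (xpos' k' kk).
have dpos (i : 'I_k.+1) : 0 < d (widen_ord kK i).
  rewrite lt_neqAle d0 andbT; apply/negP => /eqP di.
  have := lm k.+1 (leqnn _); rewrite leNgt => /negP[].
  rewrite !(big_ord_narrow kK).
  by rewrite [X in X < _](bigD1 i) //= -di mul0r prodr_gt0.
rewrite !(big_ord_narrow kK).
pose lx := \row_(i < k.+1) ln (x (widen_ord kK i)).
pose ld := \row_(i < k.+1) ln (d (widen_ord kK i)).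
suff : \sum_i f (expR (lx 0 i)) <= \sum_i f (expR (ld 0 i)).
  have E (z : 'I_K -> R) : (forall i, 0 < z (widen_ord kK i)) ->
      \sum_i f (expR ((\row_i ln (z (widen_ord kK i))) 0 i)) =
      \sum_(i < k.+1) f (z (widen_ord kK i)).
    by move=> zpos; apply: eq_bigr => i _; rewrite mxE lnK // posrE.
  by rewrite (E x) // (E d).
apply: (weak_majorization_le
  (Phi := fun z : 'rV[R]_k.+1 => \sum_i f (expR (z 0 i)))).
- move=> z i l c c01.
  apply: (@le_trans _ _ (\sum_s ((1 - c) * f (expR (z 0 s)) +
                         c * f (expR (z 0 (tperm i l s)))))).
    apply: ler_sum => s _; rewrite mxE.
    have c01' : 0 <= 1 - c <= 1 by lra.
    by have := ef (1 - c) (z 0 s) (z 0 (tperm i l s)) c01'; rewrite subKr.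
  rewrite big_split /= -!mulr_sumr.
  have <- : \sum_s f (expR (z 0 s)) = \sum_s f (expR (z 0 (tperm i l s))).
    by rewrite (reindex_inj (perm_inj (s := tperm i l))).
  by lra.
- move=> z l xz; apply: ler_sum => s _; rewrite mxE; case: eqP => // ->.
  by apply: fhomo; rewrite ?expR_ge0 // ler_expR.
- by move=> i j ij; rewrite !mxE ler_ln ?posrE ?xpos //; apply: xdec.
move=> k' kk; have := lm k' kk.
have E (z : 'I_K -> R) : (forall i, 0 < z (widen_ord kK i)) ->
    \prod_(i < K | (i < k')%N) z i =
    expR (\sum_(i < k.+1 | (i < k')%N) (\row_i ln (z (widen_ord kK i))) 0 i).
  move=> zpos; rewrite expR_sum (big_ord_narrow (leq_trans kk kK)).
  rewrite (big_ord_narrow kk); apply: eq_bigr => i _; rewrite mxE lnK ?posrE //.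
  by congr z; apply: val_inj.
by rewrite (E x) // (E d) // ler_expR.
Qed.

(** * Quadratic forms, unitary diagonalization and functional calculus *)

Definition nsq (R : realType) (z : R[i]) : R :=
  complex.Re z ^+ 2 + complex.Im z ^+ 2.

Lemma mulCconj (R : realType) (z : R[i]) : z * Num.conj z = (nsq z)%:C.
Proof. by rewrite -normCK -add_Re2_Im2. Qed.

Lemma nsq_ge0 (R : realType) (z : R[i]) : 0 <= nsq z.
Proof. by rewrite addr_ge0 ?sqr_ge0. Qed.

Lemma nsq_eq0 (R : realType) (z : R[i]) : (nsq z == 0) = (z == 0).
Proof.
rewrite -(inj_eq (@complexI R)) -mulCconj rmorph0 mulf_eq0 conjC_eq0.
by rewrite orbb.
Qed.

Lemma nsq0 (R : realType) : nsq (0 : R[i]) = 0.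
Proof. by apply/eqP; rewrite nsq_eq0. Qed.

Lemma conj_real_complex (R : realType) (a : R) : Num.conj (a%:C) = a%:C :> R[i].
Proof. by apply: conj_Creal; apply/complex_realP; exists a. Qed.

Lemma nsqM (R : realType) (z t : R[i]) : nsq (z * t) = nsq z * nsq t.
Proof.
apply: (@complexI R); rewrite [RHS]rmorphM /= -!mulCconj rmorphM /=.
by rewrite mulrACA.
Qed.

Lemma nsq_conj (R : realType) (z : R[i]) : nsq (Num.conj z) = nsq z.
Proof. by apply: (@complexI R); rewrite -!mulCconj conjCK mulrC. Qed.

Lemma nsq_real (R : realType) (a : R) : nsq a%:C = a ^+ 2.
Proof. by rewrite /nsq /= expr0n addr0. Qed.

Lemma mxCE (R : realType) m n (A : 'M[R[i]]_(m, n)) i j :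
  (A^t*) i j = Num.conj (A j i).
Proof. by rewrite !mxE. Qed.

Lemma mulmxC (R : realType) m n p (A : 'M[R[i]]_(m, n)) (B : 'M_(n, p)) :
  (A *m B)^t* = B^t* *m A^t*.
Proof. by rewrite trmx_mul map_mxM. Qed.

Lemma unitary_mulVmx (R : realType) n (U : 'M[R[i]]_n) :
  U \is unitarymx -> U^t* *m U = 1%:M.
Proof. by move=> Uu; rewrite -invmx_unitary // mulVmx // unitarymx_unit. Qed.

Lemma hermsymP (R : realType) n (A : 'M[R[i]]_n) :
  reflect (A^t* = A) (A \is hermsymmx).
Proof.
apply: (iffP (is_hermitianmxP _ _ _)); rewrite expr0 scale1r => E.
  exact: esym.
exact: esym.
Qed.

Definition sqn (R : realType) n (x : 'rV[R[i]]_n) : R := \sum_s nsq (x 0 s).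

(** Vectors are rows, so eigenvectors will be the rows of a unitary matrix. For Hermitian [P] the
    form is real, and the real part only moves it from [R[i]] to [R]. *)
Definition qf (R : realType) n (P : 'M[R[i]]_n) (x : 'rV[R[i]]_n) : R :=
  complex.Re ((x *m P *m x^t*) 0 0).

Lemma sqn_ge0 (R : realType) n (x : 'rV[R[i]]_n) : 0 <= sqn x.
Proof. by apply: sumr_ge0 => s _; apply: nsq_ge0. Qed.

Lemma sqn_eq0 (R : realType) n (x : 'rV[R[i]]_n) : (sqn x == 0) = (x == 0).
Proof.
rewrite psumr_eq0 => [|s _]; last exact: nsq_ge0.
apply/allP/eqP => [x0|-> s _]; last by rewrite mxE nsq0 eqxx.
apply/rowP => s; apply/eqP; rewrite mxE -nsq_eq0.
by apply: x0; rewrite mem_index_enum.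
Qed.

Lemma mulmxC_sqn (R : realType) n (x : 'rV[R[i]]_n) :
  (x *m x^t*) 0 0 = (sqn x)%:C.
Proof.
by rewrite mxE rmorph_sum /=; apply: eq_bigr => s _; rewrite mxCE mulCconj.
Qed.

Lemma qfD (R : realType) n (P Q : 'M[R[i]]_n) (x : 'rV[R[i]]_n) :
  qf (P + Q) x = qf P x + qf Q x.
Proof. by rewrite /qf mulmxDr mulmxDl mxE; case: (_ 0 0); case: (_ 0 0). Qed.

Lemma qfN (R : realType) n (P : 'M[R[i]]_n) (x : 'rV[R[i]]_n) :
  qf (- P) x = - qf P x.
Proof. by rewrite /qf mulmxN mulNmx mxE; case: (_ 0 0). Qed.

Lemma qf_sum (R : realType) n (I : Type) (r : seq I) (P : pred I)
    (F : I -> 'M[R[i]]_n) (x : 'rV[R[i]]_n) :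
  qf (\sum_(i <- r | P i) F i) x = \sum_(i <- r | P i) qf (F i) x.
Proof.
apply: (big_morph (fun Q => qf Q x)) => [A B|]; first exact: qfD.
by rewrite /qf mulmx0 mul0mx mxE.
Qed.

Lemma qf_congr (R : realType) k n (V : 'M[R[i]]_(k, n)) (P : 'M[R[i]]_n)
    (x : 'rV[R[i]]_k) : qf (V *m P *m V^t*) x = qf P (x *m V).
Proof. by rewrite /qf mulmxC !mulmxA. Qed.

Lemma qf_diag (R : realType) n (d : 'rV[R]_n) (x : 'rV[R[i]]_n) :
  qf (diag_mx (map_mx (real_complex R) d)) x = \sum_s d 0 s * nsq (x 0 s).
Proof.
apply: (@complexI R); rewrite /qf.
have -> : (x *m diag_mx (map_mx (real_complex R) d) *m x^t*) 0 0 =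
    (\sum_s d 0 s * nsq (x 0 s))%:C.
  rewrite mxE rmorph_sum /=; apply: eq_bigr => s _.
  by rewrite mul_mx_diag mxE mxCE [RHS]rmorphM /= -mulCconj mxE mulrAC mulrC.
by [].
Qed.

Definition eigdec (R : realType) n (P U : 'M[R[i]]_n) (d : 'rV[R]_n) : Prop :=
  U \is unitarymx /\ P = U^t* *m diag_mx (map_mx (real_complex R) d) *m U.

Lemma qf_eig (R : realType) n (P U : 'M[R[i]]_n) (d : 'rV[R]_n) x :
  eigdec P U d -> qf P x = \sum_s d 0 s * nsq ((x *m U^t*) 0 s).
Proof. by move=> [_ ->]; rewrite -[U in _ *m U]trmxCK qf_congr qf_diag. Qed.

Lemma sqn_unitary (R : realType) n (U : 'M[R[i]]_n) (x : 'rV[R[i]]_n) :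
  U \is unitarymx -> sqn (x *m U^t*) = sqn x.
Proof.
move=> Uu; apply: (@complexI R); rewrite -!mulmxC_sqn mulmxC trmxCK.
by rewrite mulmxA mulmxKtV.
Qed.

Lemma sqn_isometry (R : realType) k n (V : 'M[R[i]]_(k, n)) (x : 'rV[R[i]]_k) :
  V \is unitarymx -> sqn (x *m V) = sqn x.
Proof.
move=> Vu; apply: (@complexI R).
by rewrite -!mulmxC_sqn mulmxC mulmxA mulmxtVK.
Qed.

Lemma eigdec_herm (R : realType) n (P U : 'M[R[i]]_n) d :
  eigdec P U d -> P \is hermsymmx.
Proof.
move=> [Uu ->]; apply/hermsymP; rewrite !mulmxC trmxCK tr_diag_mx map_diag_mx.
have -> : map_mx Num.conj (map_mx (real_complex R) d) =
    map_mx (real_complex R) d.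
  by apply/matrixP => i j; rewrite !mxE conj_real_complex.
by rewrite mulmxA.
Qed.

Lemma row_unitary_coord (R : realType) n (U : 'M[R[i]]_n) s r :
  U \is unitarymx -> (row s U *m U^t*) 0 r = (s == r)%:R.
Proof.
by move=> /unitarymxP Uu; rewrite -row_mul Uu row1 !mxE eqxx eq_sym.
Qed.

Lemma qf_eig_row (R : realType) n (P U : 'M[R[i]]_n) d s :
  eigdec P U d -> qf P (row s U) = d 0 s.
Proof.
move=> eP; rewrite (qf_eig _ eP) (bigD1 s) //= big1 => [|r rs].
  rewrite row_unitary_coord ?eqxx; last by case: eP.
  by rewrite (nsq_real 1) expr1n mulr1 addr0.
rewrite row_unitary_coord; last by case: eP.
by rewrite eq_sym (negPf rs) nsq0 mulr0.
Qed.

Lemma sqn_unitary_row (R : realType) k n (U : 'M[R[i]]_(k, n)) s :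
  U \is unitarymx -> sqn (row s U) = 1.
Proof.
move=> /unitarymxP UU; apply: (@complexI R); rewrite -mulmxC_sqn.
have := congr1 (fun X : 'M_k => X s s) UU; rewrite mxE [RHS]mxE eqxx => E.
by apply: etrans E; rewrite mxE; apply: eq_bigr => j _; rewrite !mxE.
Qed.

Lemma herm_eigdec (R : realType) n (P : 'M[R[i]]_n) : P \is hermsymmx ->
  eigdec P (spectralmx P) (map_mx (@complex.Re R) (spectral_diag P)).
Proof.
move=> Ph; split; first exact: spectral_unitarymx.
have -> : map_mx (real_complex R) (map_mx (@complex.Re R) (spectral_diag P)) =
    spectral_diag P.
  apply/matrixP => i j; rewrite !mxE.
  have /mxOverP/(_ i j) := hermitian_spectral_diag_real Ph.
  by move=> /RRe_real.
rewrite -(invmx_unitary (spectral_unitarymx P)).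
exact: (orthomx_spectralP (hermitian_normalmx Ph)).
Qed.

Lemma herm_eigdec_fam (R : realType) n (I : Type) (P : I -> 'M[R[i]]_n) :
  (forall i, P i \is hermsymmx) ->
  exists U d, forall i, eigdec (P i) (U i) (d i).
Proof.
move=> Ph; exists (fun i => spectralmx (P i)).
exists (fun i => map_mx (@complex.Re R) (spectral_diag (P i))) => i.
exact: herm_eigdec.
Qed.

(** In eigenbases the relation P Z = Z Q reads p_i Y_ij = Y_ij q_j, so p_i = q_j wherever Y_ij is
    nonzero, and then f(p_i) = f(q_j) for an arbitrary f. With Z = 1 this gives the independence of
    f(P) from the diagonalization. *)
Lemma eig_intertwine (R : realType) n (f : R -> R) (P Q U V Z : 'M[R[i]]_n)
    (p q : 'rV[R]_n) : eigdec P U p -> eigdec Q V q -> P *m Z = Z *m Q ->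
  U^t* *m diag_mx (map_mx (real_complex R) (map_mx f p)) *m U *m Z =
  Z *m (V^t* *m diag_mx (map_mx (real_complex R) (map_mx f q)) *m V).
Proof.
move=> [Uu ->] [Vu ->] PZ.
pose Y := U *m Z *m V^t*.
have ZE : Z = U^t* *m Y *m V.
  by rewrite /Y !mulmxA (unitary_mulVmx Uu) mul1mx (mulmxKtV _ Vu).
have /unitarymxP Uu' := Uu.
have /unitarymxP Vu' := Vu.
have : diag_mx (map_mx (real_complex R) p) *m Y =
       Y *m diag_mx (map_mx (real_complex R) q).
  have := congr1 (fun X => U *m X *m V^t*) PZ.
  rewrite !mulmxA Uu' mul1mx /Y => ->.
  by rewrite -!mulmxA Vu' mulmx1.
move=> /matrixP DY.
have {DY} DY : diag_mx (map_mx (real_complex R) (map_mx f p)) *m Y =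
       Y *m diag_mx (map_mx (real_complex R) (map_mx f q)).
  apply/matrixP => i j; have := DY i j.
  rewrite !mul_diag_mx !mul_mx_diag !mxE => E.
  have [-> |Y0] := eqVneq (\sum_j0 (U *m Z) i j0 * (V^t*) j0 j) 0.
    by rewrite mulr0 mul0r.
  move: E; rewrite mulrC => /(mulfI Y0)/(@complexI R) ->.
  by rewrite mulrC.
clearbody Y; rewrite ZE !mulmxA (mulmxtVK _ Uu) (mulmxtVK _ Vu).
by congr (_ *m V); rewrite -mulmxA DY mulmxA.
Qed.

Lemma eigdec_fun (R : realType) n (f : R -> R) (P U : 'M[R[i]]_n) d :
  eigdec P U d -> eigdec (fun_mx f P) U (map_mx f d).
Proof.
move=> eP; split; first by case: eP.
have eS := herm_eigdec (eigdec_herm eP).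
have comm1 : P *m 1%:M = 1%:M *m P by rewrite mul1mx mulmx1.
have := eig_intertwine f eS eP comm1; rewrite mulmx1 mul1mx => <-.
rewrite /fun_mx (invmx_unitary (spectral_unitarymx P)).
have -> : map_mx (fun z : R[i] => (f (complex.Re z))%:C) (spectral_diag P) =
    map_mx (real_complex R)
      (map_mx f (map_mx (@complex.Re R) (spectral_diag P))).
  by apply/matrixP => i j; rewrite !mxE.
by [].
Qed.

Lemma fun_mx_intertwine (R : realType) n (f : R -> R) (P Q Z : 'M[R[i]]_n) :
  P \is hermsymmx -> Q \is hermsymmx -> P *m Z = Z *m Q ->
  fun_mx f P *m Z = Z *m fun_mx f Q.
Proof.
move=> /herm_eigdec eP /herm_eigdec eQ PZ.
have [_ ->] := eigdec_fun f eP; have [_ ->] := eigdec_fun f eQ.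
exact: (eig_intertwine f eP eQ PZ).
Qed.

Lemma gram_herm (R : realType) m n (X : 'M[R[i]]_(m, n)) :
  X^t* *m X \is hermsymmx.
Proof. by apply/hermsymP; rewrite mulmxC trmxCK. Qed.

Lemma qf_gram (R : realType) m n (X : 'M[R[i]]_(m, n)) (x : 'rV[R[i]]_n) :
  qf (X^t* *m X) x = sqn (x *m X^t*).
Proof.
apply: (@complexI R); rewrite /qf -mulmxC_sqn mulmxC trmxCK !mulmxA.
by rewrite -[x *m _ *m X *m _]mulmxA -[X in X *m x^t*]trmxCK -mulmxC mulmxC_sqn.
Qed.

Lemma gram_eig_ge0 (R : realType) m n (X : 'M[R[i]]_(m, n)) U d s :
  eigdec (X^t* *m X) U d -> 0 <= d 0 s.
Proof.
by move=> eP; rewrite -(qf_eig_row s eP) qf_gram sqn_ge0.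
Qed.

Lemma eigdec_mulmx (R : realType) n (P Q U : 'M[R[i]]_n) (p q : 'rV[R]_n) :
  eigdec P U p -> eigdec Q U q -> eigdec (P *m Q) U (\row_s (p 0 s * q 0 s)).
Proof.
move=> [Uu ->] [_ ->]; split=> //.
have -> : map_mx (real_complex R) (\row_s (p 0 s * q 0 s)) =
    \row_s (map_mx (real_complex R) p 0 s * map_mx (real_complex R) q 0 s).
  by apply/rowP => s; rewrite !mxE rmorphM.
by rewrite -mulmx_diag !mulmxA (mulmxtVK _ Uu).
Qed.

Lemma eigdec_abs_herm (R : realType) n (A U : 'M[R[i]]_n) a :
  eigdec A U a -> eigdec (abs_mx A) U (map_mx Num.norm a).
Proof.
move=> eA; have /hermsymP AE := eigdec_herm eA.
have := eigdec_fun Num.sqrt (eigdec_mulmx eA eA); rewrite -{1}AE.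
congr eigdec; apply/rowP => j; rewrite !mxE -expr2; exact: sqrtr_sqr.
Qed.

(** * Positive semi-definite matrices and the estimate of a single block *)

Definition psd (R : realType) n (P : 'M[R[i]]_n) : Prop :=
  P \is hermsymmx /\ forall x, 0 <= qf P x.

Lemma psd_eig_ge0 (R : realType) n (P U : 'M[R[i]]_n) d s :
  psd P -> eigdec P U d -> 0 <= d 0 s.
Proof. by move=> [_ P0] eP; rewrite -(qf_eig_row s eP). Qed.

Lemma eig_psd (R : realType) n (P U : 'M[R[i]]_n) d :
  eigdec P U d -> (forall s, 0 <= d 0 s) -> psd P.
Proof.
move=> eP d0; split=> [|x]; first exact: eigdec_herm eP.
by rewrite (qf_eig _ eP); apply: sumr_ge0 => s _; rewrite mulr_ge0 ?nsq_ge0.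
Qed.

Lemma psd_sum (R : realType) n (I : finType) (P : I -> 'M[R[i]]_n) :
  (forall i, psd (P i)) -> psd (\sum_i P i).
Proof.
move=> P0; split=> [|x]; last first.
  by rewrite qf_sum; apply: sumr_ge0 => i _; case: (P0 i).
apply/hermsymP; rewrite linear_sum /= map_mx_sum; apply: eq_bigr => i _.
by apply/hermsymP; case: (P0 i).
Qed.

Lemma psd_fun (R : realType) n (f : R -> R) (P : 'M[R[i]]_n) :
  (forall t, 0 <= t -> 0 <= f t) -> psd P -> psd (fun_mx f P).
Proof.
move=> f0 P0; have eP := herm_eigdec P0.1.
apply: eig_psd (eigdec_fun f eP) _ => s.
by rewrite [X in _ <= X]mxE f0 // (psd_eig_ge0 s P0 eP).
Qed.

Lemma psd_abs (R : realType) n (X : 'M[R[i]]_n) : psd (abs_mx X).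
Proof.
have eX := eigdec_fun Num.sqrt (herm_eigdec (gram_herm X)).
by apply: eig_psd eX _ => s; rewrite [X in _ <= X]mxE sqrtr_ge0.
Qed.

Lemma fun_mxM (R : realType) n (g : R -> R) (P : 'M[R[i]]_n) :
  P \is hermsymmx -> fun_mx g P *m P = fun_mx (fun t => g t * t) P.
Proof.
move=> /herm_eigdec; move: (spectralmx P) (map_mx _ _) => U d eP.
have [_ ->] := eigdec_fun (fun t => g t * t) eP.
have [_ ->] := eigdec_mulmx (eigdec_fun g eP) eP.
have -> // : \row_s ((map_mx g d) 0 s * d 0 s) = map_mx (fun t => g t * t) d.
by apply/rowP => j; rewrite !mxE.
Qed.

Lemma Re_mul_amgm (R : realType) (a b : R[i]) (p : R) : 0 < p ->
  `|complex.Re (a * b)| <= 2^-1 * (p^-1 * nsq a + p * nsq b).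
Proof.
case: a => a1 a2; case: b => b1 b2 p0; rewrite /nsq /=.
(* The values e = 1 and e = -1 give the two signs of the absolute value; the expression is the
   squared modulus of a + e p conj(b), divided by p. *)
have H e : e ^+ 2 = 1 ->
    0 <= p^-1 * (a1 ^+ 2 + a2 ^+ 2) + p * (b1 ^+ 2 + b2 ^+ 2) +
         2 * e * (a1 * b1 - a2 * b2).
  move=> e2.
  have -> : p^-1 * (a1 ^+ 2 + a2 ^+ 2) + p * (b1 ^+ 2 + b2 ^+ 2) +
         2 * e * (a1 * b1 - a2 * b2) =
      p^-1 * ((a1 + e * p * b1) ^+ 2 + (a2 - e * p * b2) ^+ 2).
    rewrite !sqrrD sqrrN !exprMn e2; field; exact: lt0r_neq0.
  by rewrite mulr_ge0 ?invr_ge0 ?(ltW p0) // addr_ge0 ?sqr_ge0.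
have := H 1 (expr1n _ _); have := H (-1); rewrite sqrrN expr1n => /(_ erefl).
by rewrite ler_norml; lra.
Qed.

(* With X = V |X|, the left-hand side is the pairing of |X^*|^(1/2) x and
   V |X|^(1/2) y; the polar factor V is avoided by the identity
   X |X|^-1 X^* = |X^*|. *)
Lemma Re_form_le_abs (R : realType) n (X : 'M[R[i]]_n) (x y : 'rV[R[i]]_n) :
  `|complex.Re ((x *m X *m y^t*) 0 0)| <=
  2^-1 * (qf (abs_mx (X^t*)) x + qf (abs_mx X) y).
Proof.
have [W [d eG]] : exists W d, eigdec (X^t* *m X) W d.
  by do 2 eexists; exact: herm_eigdec (gram_herm X).
have Wu : W \is unitarymx by case: eG.
have d0 s : 0 <= d 0 s := gram_eig_ge0 s eG.
have -> : qf (abs_mx X) y =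
    \sum_s Num.sqrt (d 0 s) * nsq ((y *m W^t*) 0 s).
  by rewrite (qf_eig _ (eigdec_fun Num.sqrt eG)); under eq_bigr do rewrite mxE.
pose phi (t : R) := (Num.sqrt t)^-1.
have -> : qf (abs_mx (X^t*)) x =
    \sum_s phi (d 0 s) * nsq ((x *m X *m W^t*) 0 s).
  transitivity (qf (fun_mx phi (X^t* *m X)) (x *m X)); last first.
    by rewrite (qf_eig _ (eigdec_fun phi eG)); under eq_bigr do rewrite mxE.
  rewrite -qf_congr; congr qf.
  have hG := gram_herm (X^t*); rewrite trmxCK in hG.
  have <- := fun_mx_intertwine phi hG (gram_herm X) (esym (mulmxA _ _ _)).
  rewrite -mulmxA (fun_mxM _ hG) /abs_mx trmxCK.
  congr fun_mx; apply: funext => t; rewrite /phi.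
  have [t0|t0] := leP t 0; first by rewrite ler0_sqrtr // invr0 mul0r.
  by rewrite -{3}(sqr_sqrtr (ltW t0)) expr2 mulKf // sqrtr_eq0 -ltNge.
have -> : (x *m X *m y^t*) 0 0 =
    \sum_s (x *m X *m W^t*) 0 s * Num.conj ((y *m W^t*) 0 s).
  have -> : x *m X *m y^t* = x *m X *m W^t* *m (y *m W^t*)^t*.
    rewrite mulmxC trmxCK !mulmxA -[_ *m W^t* *m W]mulmxA unitary_mulVmx //.
    by rewrite mulmx1.
  by rewrite mxE; apply: eq_bigr => s _; rewrite mxCE.
rewrite raddf_sum -big_split mulr_sumr /=.
apply: le_trans (ler_norm_sum _ _ _) _; apply: ler_sum => s _.
(* For d_s > 0 the inequality is the weighted one with p = sqrt(d_s). For d_s = 0 the eigenvector is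
   killed by X^*, so the left-hand term is 0. *)
have [ds0|ds0] := eqVneq (d 0 s) 0; last first.
  rewrite -[nsq ((y *m _) 0 s)]nsq_conj; apply: Re_mul_amgm.
  by rewrite sqrtr_gt0 lt_neqAle eq_sym ds0 d0.
have -> : (x *m X *m W^t*) 0 s = 0.
  have XW0 : row s W *m X^t* = 0.
    apply/eqP; rewrite -sqn_eq0 -qf_gram.
    by rewrite (qf_eig_row s eG) ds0.
  have -> : (x *m X *m W^t*) 0 s = (x *m (row s W *m X^t*)^t*) 0 0.
    rewrite mulmxC trmxCK mulmxA !mxE; apply: eq_bigr => j _.
    by rewrite !mxE.
  by rewrite XW0 trmx0 map_mx0 mulmx0 mxE.
by rewrite mul0r /= normr0 ds0 sqrtr0 nsq0 mul0r mulr0 addr0 mulr0.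
Qed.

(** * Eigenvalue inequalities: compressions, determinants, concave functions of sums *)

Lemma eigdec_perm (R : realType) n (P U : 'M[R[i]]_n) d (s : 'S_n) :
  eigdec P U d -> eigdec P (row_perm s U) (col_perm s d).
Proof.
move=> [Uu ->]; split.
  apply/unitarymxP/matrixP => i j; have /unitarymxP/matrixP := Uu.
  move=> /(_ (s i) (s j)); rewrite !mxE (inj_eq perm_inj) => <-.
  by apply: eq_bigr => k _; rewrite !mxE.
apply/matrixP => i j; rewrite !mxE (reindex_inj (@perm_inj _ s)).
by apply: eq_bigr => k _; rewrite !mul_mx_diag !mxE.
Qed.

(** The key [g] is [id] to sort eigenvalues, and [Num.norm] to sort a Hermitian matrix by its
    singular values. *)
Lemma herm_eigdec_sorted (R : realType) n (P : 'M[R[i]]_n) (g : R -> R) :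
  P \is hermsymmx -> exists U d, eigdec P U d /\
    forall i j : 'I_n, (i <= j)%N -> g (d 0 j) <= g (d 0 i).
Proof.
move=> /herm_eigdec eP.
have [s sP] := perm_nonincreasing (fun i =>
  g ((map_mx (@complex.Re R) (spectral_diag P)) 0 i)).
do 2 eexists; split; first exact: (eigdec_perm s eP).
by move=> i j /sP; rewrite !mxE.
Qed.

Lemma qf_ge0_ker (R : realType) n (P : 'M[R[i]]_n) (x : 'rV[R[i]]_n) :
  P \is hermsymmx -> (forall y, 0 <= qf P y) -> qf P x = 0 -> x *m P = 0.
Proof.
move=> /herm_eigdec; move: (spectralmx P) (map_mx _ _) => U d eP P0.
have d0 s : 0 <= d 0 s by rewrite -(qf_eig_row s eP).
rewrite (qf_eig _ eP) => /eqP; rewrite psumr_eq0 => [/allP xP|s _]; last first.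
  by rewrite mulr_ge0 ?nsq_ge0.
case: eP => _ ->; rewrite !mulmxA.
suff -> : x *m U^t* *m diag_mx (map_mx (real_complex R) d) = 0.
  by rewrite mul0mx.
apply/rowP => s; have := xP s (mem_index_enum _).
rewrite mulf_eq0 nsq_eq0 mul_mx_diag => E.
rewrite [LHS]mxE [RHS]mxE [X in _ * X]mxE.
by case/orP: E => /eqP ->; rewrite ?mulr0 ?mul0r.
Qed.

(* Courant-Fischer: a nonzero vector in the span of the first s + 1
   eigenvectors of Q, mapped by V, is orthogonal to the first s of D. *)
Lemma compression_eig_le (R : realType) k n (V : 'M[R[i]]_(k, n))
    (D U : 'M[R[i]]_n) (d : 'rV[R]_n) (W : 'M[R[i]]_k) (q : 'rV[R]_k)
    (s : 'I_k) (t : 'I_n) :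
  V \is unitarymx -> eigdec D U d -> eigdec (V *m D *m V^t*) W q ->
  (forall i j : 'I_n, (i <= j)%N -> d 0 j <= d 0 i) ->
  (forall i j : 'I_k, (i <= j)%N -> q 0 j <= q 0 i) ->
  s = t :> nat -> q 0 s <= d 0 t.
Proof.
move=> Vu eD eQ ddec qdec st.
have Uu : U \is unitarymx by case: eD.
have Wu : W \is unitarymx by case: eQ.
pose f (i : 'I_s.+1) : 'I_k := widen_ord (ltn_ord s) i.
have sn : (s <= n)%N by rewrite st ltnW.
pose g (i : 'I_s) : 'I_n := widen_ord sn i.
pose G := W *m V *m U^t*.
(* Rows of [G] are the eigenvectors of the compression, mapped by V and written in the eigenbasis of
   D. Keeping s + 1 rows and s columns forces a nonzero left null vector. *)
pose H := colsub g (rowsub f G).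
have [c0 c0H c0n0] : exists2 c0 : 'rV_s.+1, c0 *m H = 0 & c0 != 0.
  have : kermx H != 0.
    by rewrite -mxrank_eq0 mxrank_ker subn_eq0 -ltnNge ltnS rank_leq_col.
  by move=> /rowV0Pn[v /sub_kermxP vH vn0]; exists v.
pose c := c0 *m rowsub f (1%:M : 'M[R[i]]_k).
have cE j : c 0 j = \sum_i c0 0 i * (f i == j)%:R.
  by rewrite mxE; apply: eq_bigr => i _; rewrite !mxE.
have cf i : c 0 (f i) = c0 0 i.
  rewrite cE (bigD1 i) //= eqxx mulr1 big1 ?addr0 // => j ji.
  by rewrite -(inj_eq val_inj) /= (inj_eq val_inj) (negPf ji) mulr0.
have c_gt (j : 'I_k) : (s < j)%N -> c 0 j = 0.
  move=> sj; rewrite cE big1 // => i _; case: eqP => [fij|]; rewrite ?mulr0 //.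
  by move: sj; rewrite -fij /= ltnNge -ltnS ltn_ord.
have cn0 : 0 < sqn c.
  rewrite lt_neqAle sqn_ge0 andbT eq_sym sqn_eq0.
  by apply: contraNneq c0n0 => c_0; apply/eqP/rowP => i; rewrite -cf c_0 !mxE.
have cG (r : 'I_n) : (r < s)%N -> (c *m G) 0 r = 0.
  move=> rs; have := congr1 (fun X : 'rV_s => X 0 (Ordinal rs)) c0H.
  rewrite [RHS]mxE => <-; rewrite /c -mulmxA mul_rowsub_mx mul1mx !mxE.
  apply: eq_bigr => i _; rewrite !mxE; congr (_ * _).
  apply: eq_bigr => j _; rewrite !mxE.
  by congr (_ * Num.conj (U _ _)); apply: val_inj.
have qE : qf D (c *m W *m V) = \sum_j q 0 j * nsq (c 0 j).
  rewrite -qf_congr (qf_eig _ eQ); apply: eq_bigr => j _.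
  by rewrite mulmxtVK.
have dE : qf D (c *m W *m V) = \sum_r d 0 r * nsq ((c *m G) 0 r).
  by rewrite (qf_eig _ eD) /G !mulmxA.
have sG : sqn (c *m G) = sqn c.
  by rewrite /G !mulmxA (sqn_unitary _ Uu) (sqn_isometry _ Vu)
    (sqn_isometry _ Wu).
have lower : q 0 s * sqn c <= qf D (c *m W *m V).
  rewrite qE mulr_sumr; apply: ler_sum => j _.
  have [sj|js] := ltnP s j; first by rewrite c_gt // nsq0 !mulr0.
  by rewrite ler_wpM2r ?nsq_ge0 ?qdec.
have upper : qf D (c *m W *m V) <= d 0 t * sqn c.
  rewrite dE -sG mulr_sumr; apply: ler_sum => r _.
  have [rs|sr] := ltnP r s; first by rewrite cG // nsq0 !mulr0.
  by rewrite ler_wpM2r ?nsq_ge0 ?ddec // -st.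
by rewrite -(ler_pM2r cn0) (le_trans lower).
Qed.

Lemma nsq_det_unitary (R : realType) n (U : 'M[R[i]]_n) :
  U \is unitarymx -> nsq (\det U) = 1.
Proof.
move=> /unitarymxP /(congr1 determinant); rewrite det_mulmx det1.
rewrite det_map_mx det_tr mulCconj => /(@complexI R); exact.
Qed.

Lemma det_eig (R : realType) n (P U : 'M[R[i]]_n) d :
  eigdec P U d -> \det P = (\prod_s d 0 s)%:C.
Proof.
move=> [Uu ->]; rewrite !det_mulmx det_diag mulrAC -det_mulmx.
rewrite unitary_mulVmx // det1 mul1r rmorph_prod.
by apply: eq_bigr => s _; rewrite mxE.
Qed.

(* Q^(-1/2) L Q^(-1/2) is a Hermitian contraction. *)
Lemma prod_diag_le_prod_eig (R : realType) k (l : 'rV[R]_k) (Q W : 'M[R[i]]_k)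
    (q : 'rV[R]_k) :
  (forall s, l 0 s != 0) -> eigdec Q W q ->
  (forall x, `|qf (diag_mx (map_mx (real_complex R) l)) x| <= qf Q x) ->
  \prod_s `|l 0 s| <= \prod_s q 0 s.
Proof.
move=> l0 eQ; set L := diag_mx _ => LQ.
have Wu : W \is unitarymx by case: eQ.
have Lh : L^t* = L.
  rewrite tr_diag_mx map_diag_mx -map_mx_comp; congr diag_mx.
  by apply/rowP => i; rewrite !mxE /= conj_real_complex.
have Qh : Q^t* = Q by apply/hermsymP/eigdec_herm/eQ.
have QL0 x : 0 <= qf (Q + L) x.
  by rewrite qfD; have := LQ x; rewrite ler_norml; lra.
have QNL0 x : 0 <= qf (Q - L) x.
  by rewrite qfD qfN; have := LQ x; rewrite ler_norml; lra.
(* If q_s = 0, the form of L vanishes at its eigenvector x, so the semi-definite matrices Q + L and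
   Q - L both kill x. Then L kills x, although its diagonal has no zero. *)
have q_gt0 s : 0 < q 0 s.
  have qs := qf_eig_row s eQ.
  rewrite lt_neqAle -{2}qs (le_trans _ (LQ _)) ?normr_ge0 // andbT.
  apply/negP => /eqP q0; set x := row s W in qs.
  have Lx0 : qf L x = 0.
    by apply/eqP; rewrite -normr_le0; have := LQ x; rewrite qs -q0.
  have x1 : x *m (Q + L) = 0.
    apply: qf_ge0_ker => //; last by rewrite qfD qs Lx0 -q0 addr0.
    by apply/hermsymP; rewrite linearD /= map_mxD Qh Lh.
  have x2 : x *m (Q - L) = 0.
    apply: qf_ge0_ker => //; last by rewrite qfD qfN qs Lx0 -q0 subr0.
    by apply/hermsymP; rewrite linearB /= map_mxB Qh Lh.
  have xL : x *m L = 0.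
    move: x1 x2; rewrite mulmxDr mulmxBr => /eqP; rewrite addr_eq0 => /eqP->.
    move=> /eqP; rewrite -opprD oppr_eq0 -mulr2n -scaler_nat.
    by rewrite scaler_eq0 pnatr_eq0 => /eqP.
  have x0 : x = 0.
    apply/rowP => j; have := congr1 (fun y : 'rV_k => y 0 j) xL.
    rewrite mul_mx_diag [LHS]mxE [RHS]mxE [X in _ * X]mxE => /eqP.
    rewrite mulf_eq0 => /orP[/eqP->|]; first by rewrite mxE.
    rewrite -(rmorph0 (real_complex R)) (inj_eq (@complexI R)).
    by rewrite (negPf (l0 j)).
  have := sqn_unitary_row s Wu; rewrite -/x x0 => /eqP.
  by rewrite /sqn big1 => [|? _]; rewrite ?mxE ?nsq0 // eq_sym oner_eq0.
pose r := map_mx (fun t : R => (Num.sqrt t)^-1) q.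
(* [S] is Q^(-1/2) up to a unitary left factor, so S Q S^* = 1 and the bound of L by Q becomes the
   bound of [K] by 1. *)
pose S := diag_mx (map_mx (real_complex R) r) *m W.
pose K := S *m L *m S^t*.
have KP z : `|qf K z| <= sqn z.
  rewrite qf_congr (le_trans (LQ _)) // (qf_eig _ eQ) le_eqVlt; apply/orP; left.
  apply/eqP; apply: eq_bigr => s _.
  rewrite /S mulmxA mulmxtVK // mul_mx_diag !mxE nsqM nsq_real exprVn.
  by rewrite sqr_sqrtr ?ltW // mulrCA divff ?mulr1 // gt_eqF.
have Kh : K \is hermsymmx.
  by apply/hermsymP; rewrite /K mulmxC trmxCK (mulmxC S L) Lh mulmxA.
have [Y [kap eK]] : exists Y kap, eigdec K Y kap.
  by do 2 eexists; exact: herm_eigdec Kh.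
have Yu : Y \is unitarymx by case: eK.
have kap1 s : `|kap 0 s| <= 1.
  by rewrite -(qf_eig_row s eK) -(sqn_unitary_row s Yu).
(* The conclusion is |det K| <= 1, as det K is |det S|^2 det L, the product of the l_s divided by
   that of the q_s. *)
have detS : nsq (\det S) = \prod_s (q 0 s)^-1.
  rewrite /S det_mulmx nsqM.
  rewrite (nsq_det_unitary Wu) mulr1.
  rewrite det_diag.
  have -> : \prod_i (map_mx (real_complex R) r) 0 i = (\prod_i r 0 i)%:C.
    by rewrite rmorph_prod; apply: eq_bigr => s _; rewrite mxE.
  rewrite nsq_real -prodrXl; apply: eq_bigr => s _.
  by rewrite mxE exprVn sqr_sqrtr // ltW.
have prodE : \prod_s kap 0 s = (\prod_s (q 0 s)^-1) * \prod_s l 0 s.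
  apply: (@complexI R); rewrite -(det_eig eK) [RHS]rmorphM /= -detS.
  have detL : \det L = (\prod_s l 0 s)%:C.
    by rewrite det_diag rmorph_prod; apply: eq_bigr => s _; rewrite mxE.
  rewrite /K det_mulmx (det_mulmx S L) det_map_mx det_tr detL.
  by move: (\det S) (_%:C) => a b; rewrite -mulCconj; apply: mulrAC.
have prodq : 0 < \prod_s q 0 s by apply: prodr_gt0.
have : \prod_s `|kap 0 s| <= 1.
  by apply: prodr_ile1 => s _; rewrite normr_ge0 kap1.
rewrite -normr_prod prodE normrM prodfV ger0_norm ?invr_ge0 ?(ltW prodq) //.
by rewrite normr_prod ler_pdivrMl // mulr1.
Qed.

Lemma eigdec_mul (R : realType) n (P U : 'M[R[i]]_n) d :
  eigdec P U d -> U *m P = diag_mx (map_mx (real_complex R) d) *m U.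
Proof. by move=> [/unitarymxP UU ->]; rewrite !mulmxA UU mul1mx. Qed.

(** On the span of the first k eigenvectors, A is an invertible diagonal matrix dominated in both
    signs by the compression of D. The determinant of that compression is at most the product of the
    top k eigenvalues of D, by Courant-Fischer. *)
Lemma prod_abs_eig_le (R : realType) n (A U D V : 'M[R[i]]_n) (a d : 'rV[R]_n)
    (k : nat) :
  eigdec A U a -> eigdec D V d ->
  (forall i j : 'I_n, (i <= j)%N -> d 0 j <= d 0 i) ->
  (forall x, `|qf A x| <= qf D x) -> (k <= n)%N ->
  (forall s : 'I_n, (s < k)%N -> a 0 s != 0) ->
  \prod_(s < n | (s < k)%N) `|a 0 s| <= \prod_(s < n | (s < k)%N) d 0 s.
Proof.
move=> eA eD ddec AD kn a0; rewrite !(big_ord_narrow kn).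
have [/unitarymxP UU _] := eA.
pose B := rowsub (widen_ord kn) U.
have Bu : B \is unitarymx.
  apply/unitarymxP/matrixP => i j.
  have := congr1 (fun X : 'M_n => X (widen_ord kn i) (widen_ord kn j)) UU.
  rewrite !mxE -(inj_eq val_inj) /= (inj_eq val_inj) => <-.
  by apply: eq_bigr => l _; rewrite !mxE.
pose a' := \row_s a 0 (widen_ord kn s).
have BA : B *m A *m B^t* = diag_mx (map_mx (real_complex R) a').
  suff -> : B *m A = diag_mx (map_mx (real_complex R) a') *m B.
    by rewrite mulmxtVK.
  rewrite mul_rowsub_mx (eigdec_mul eA); apply/matrixP => i j.
  by rewrite !mul_diag_mx !mxE.
have Qh : B *m D *m B^t* \is hermsymmx.
  apply/hermsymP; rewrite !mulmxC trmxCK mulmxA.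
  by have /hermsymP -> := eigdec_herm eD.
have [W [q [eQ qdec]]] := herm_eigdec_sorted id Qh.
have le1 : \prod_s `|a' 0 s| <= \prod_s q 0 s.
  apply: prod_diag_le_prod_eig eQ _ => [s|x]; first by rewrite mxE a0 /=.
  by rewrite -BA !qf_congr.
have -> : \prod_(i < k) `|a 0 (widen_ord kn i)| = \prod_s `|a' 0 s|.
  by apply: eq_bigr => s _; rewrite mxE.
apply: le_trans le1 _; apply: ler_prod => s _; apply/andP; split.
  rewrite -(qf_eig_row s eQ) qf_congr; apply: le_trans (AD _); exact: normr_ge0.
exact: compression_eig_le Bu eD eQ ddec qdec _.
Qed.

(* The weights p c_l / (d_l w) have mass at most 1 by Chebyshev's sum
   inequality (1 / d is smallest on S), and barycenter p. *)
Lemma concave_top_weights (R : realType) (f : R -> R) (L : finType)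
    (c d : L -> R) (S : pred L) (p : R) :
  (forall x, 0 <= x -> 0 <= f x) -> concave_on_nonneg f ->
  (forall l, 0 <= c l) -> \sum_l c l = 1 -> (forall l, 0 <= d l) ->
  (forall l, d l = 0 -> c l = 0) -> 0 < p -> p * (\sum_l c l / d l) <= 1 ->
  (forall l, S l -> 0 < d l) -> (forall l k, S l -> ~~ S k -> d k <= d l) ->
  \sum_(l | S l) p * c l * (f (d l) / d l) <= f p * \sum_(l | S l) c l.
Proof.
move=> f0 cf c0 c1 d0 dc0 p0 pG Spos Stop.
set w := \sum_(l | S l) c l.
have w0 : 0 <= w by apply: sumr_ge0.
have [wz|wn0] := eqVneq w 0.
  rewrite wz mulr0 big1 // => l Sl.
  move/eqP: wz; rewrite psumr_eq0 // => /allP/(_ l (mem_index_enum _)).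
  by rewrite Sl => /eqP->; rewrite mulr0 mul0r.
have wpos : 0 < w by rewrite lt_neqAle eq_sym wn0.
pose GS := \sum_(l | S l) c l / d l.
pose GN := \sum_(l | ~~ S l) c l / d l.
pose wN := \sum_(l | ~~ S l) c l.
have GE : \sum_l c l / d l = GS + GN by rewrite (bigID S).
have wE : w + wN = 1 by rewrite -c1 [RHS](bigID S).
have cheb : GS * wN <= w * GN.
  rewrite /GS /wN /w /GN !big_distrlr /=; apply: ler_sum => l Sl.
  apply: ler_sum => k Sk; have [dk0|dk0] := eqVneq (d k) 0.
    by rewrite (dc0 k dk0) mul0r !mulr0.
  have dkpos : 0 < d k by rewrite lt_neqAle eq_sym dk0 d0.
  rewrite -mulrA ler_wpM2l // mulrC ler_wpM2l //.
  by rewrite lef_pV2 ?posrE //; [exact: Stop|exact: Spos].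
(* Adding w GS to both sides of [cheb] gives GS <= w (GS + GN), and p (GS + GN) <= 1 by
   hypothesis. *)
have pGS : p * GS <= w.
  have GSle : GS <= w * (GS + GN).
    by rewrite -[X in X <= _]mulr1 -wE !mulrDr [GS * w]mulrC lerD2l.
  have : p * GS <= p * (w * (GS + GN)) by rewrite ler_pM2l.
  move=> /le_trans; apply; rewrite mulrCA ger_pMr // -GE.
  exact: pG.
have [al0 d0'] : (forall l, S l -> 0 <= p * c l / (d l * w)) /\
    forall l, S l -> 0 <= d l.
  split=> // l Sl; rewrite divr_ge0 // mulr_ge0 //; exact: ltW.
have mass : \sum_(l | S l) p * c l / (d l * w) <= 1.
  have -> : \sum_(l | S l) p * c l / (d l * w) = p * GS / w.
    rewrite /GS mulr_sumr mulr_suml; apply: eq_bigr => l Sl.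
    by rewrite invfM !mulrA.
  by rewrite ler_pdivrMr // mul1r.
have := concave_jensen f0 cf al0 d0' mass.
have -> : \sum_(l | S l) p * c l / (d l * w) * d l = p.
  transitivity (\sum_(l | S l) (p / w) * c l).
    apply: eq_bigr => l Sl; have := Spos _ Sl => dl.
    by field; rewrite wn0 gt_eqF.
  by rewrite -mulr_sumr -/w divfK.
have -> : \sum_(l | S l) p * c l / (d l * w) * f (d l) =
    (\sum_(l | S l) p * c l * (f (d l) / d l)) / w.
  rewrite mulr_suml; apply: eq_bigr => l Sl; have := Spos _ Sl => dl.
  by field; rewrite wn0 gt_eqF.
by rewrite ler_pdivrMr.
Qed.

(* Bourin-Uchiyama subadditivity, tested on the spectral projection of D onto
   its top eigenspaces.  Every p v v^* in the spectral decomposition of P i lies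
   below D, which makes the rank-one estimate above available. *)
Lemma concave_top_eig_le (R : realType) (f : R -> R) n (I : finType) (i0 : I)
    (P : I -> 'M[R[i]]_n) (U : 'M[R[i]]_n) (d : 'rV[R]_n) (S : pred 'I_n) :
  (forall x, 0 <= x -> 0 <= f x) -> concave_on_nonneg f ->
  (forall i, psd (P i)) -> eigdec (\sum_i P i) U d ->
  (forall l k, S l -> ~~ S k -> d 0 k <= d 0 l) ->
  \sum_(l | S l) f (d 0 l) <=
  \sum_(l | S l) qf (\sum_i fun_mx f (P i)) (row l U).
Proof.
move=> f0 cf Ppsd eD Stop.
have [V [p eP]] := herm_eigdec_fam (fun i => (Ppsd i).1).
have p0 i r : 0 <= p i 0 r := psd_eig_ge0 r (Ppsd i) (eP i).
have fhomo := concave_ge0_homo f0 cf.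
have Uu : U \is unitarymx by case: eD.
have Vu i : V i \is unitarymx by case: (eP i).
pose c i r l := nsq ((row l U *m (V i)^t*) 0 r).
have c0 i r l : 0 <= c i r l by apply: nsq_ge0.
have P0 i x : 0 <= qf (P i) x := (Ppsd i).2 x.
have PD i x : qf (P i) x <= qf (\sum_i P i) x.
  by rewrite qf_sum (bigD1 i) //= lerDl sumr_ge0.
have pD i r x : p i 0 r * nsq ((x *m (V i)^t*) 0 r) <= qf (\sum_i P i) x.
  apply: le_trans (PD i x); rewrite (qf_eig _ (eP i)) (bigD1 r) //= lerDl.
  by apply: sumr_ge0 => s _; rewrite mulr_ge0 ?nsq_ge0.
have d0 l : 0 <= d 0 l.
  by rewrite -(qf_eig_row l eD) qf_sum sumr_ge0.
have dE l : d 0 l = \sum_i \sum_r p i 0 r * c i r l.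
  rewrite -(qf_eig_row l eD) qf_sum; apply: eq_bigr => i _.
  by rewrite (qf_eig _ (eP i)).
have fE l : qf (\sum_i fun_mx f (P i)) (row l U) =
    \sum_i \sum_r f (p i 0 r) * c i r l.
  rewrite qf_sum; apply: eq_bigr => i _.
  rewrite (qf_eig _ (eigdec_fun f (eP i))).
  by apply: eq_bigr => r _; rewrite mxE.
have cswap i r l : c i r l = nsq ((row r (V i) *m U^t*) 0 l).
  rewrite /c -[RHS]nsq_conj -mxCE mulmxC trmxCK; congr nsq.
  by rewrite !mxE; apply: eq_bigr => s _; rewrite !mxE.
have c_sum i r : \sum_l c i r l = 1.
  rewrite (eq_bigr _ (fun l _ => cswap i r l)).
  exact: etrans (sqn_unitary _ Uu) (sqn_unitary_row r (Vu i)).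
have pG i r : 0 < p i 0 r -> p i 0 r * (\sum_l c i r l / d 0 l) <= 1.
  move=> ppos; set G := \sum_l _.
  have G0 : 0 <= G by apply: sumr_ge0 => l _; rewrite divr_ge0.
  (* [z] holds the eigenbasis coordinates of v D^(-1), with inverse 0 on the kernel, where v is the
     r-th eigenvector of P_i. Testing p v^* v <= D on it gives p G^2 <= G. *)
  pose z := \row_l (Num.conj ((row l U *m (V i)^t*) 0 r) * (d 0 l)^-1%:C).
  have zG : (z *m U *m (V i)^t*) 0 r = G%:C.
    rewrite -mulmxA mxE rmorph_sum; apply: eq_bigr => l _.
    have -> : (U *m (V i)^t*) l r = (row l U *m (V i)^t*) 0 r.
      by rewrite -row_mul [RHS]mxE.
    by rewrite [z 0 l]mxE mulrAC [_ * (_ *m _) 0 r]mulrC mulCconj -rmorphM.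
  have zD : qf (\sum_i P i) (z *m U) = G.
    rewrite (qf_eig _ eD); apply: eq_bigr => l _.
    rewrite mulmxtVK // mxE nsqM nsq_conj nsq_real -/(c i r l).
    have [->|dn0] := eqVneq (d 0 l) 0; first by rewrite invr0 mul0r mulr0.
    by field.
  have := pD i r (z *m U); rewrite zG zD nsq_real.
  have [-> _|Gn0] := eqVneq G 0; first by rewrite mulr0.
  have Gpos : 0 < G by rewrite lt_neqAle eq_sym Gn0.
  by rewrite expr2 mulrA -[X in _ <= X]mul1r ler_pM2r.
(* The weights divide by eigenvalues of D, so zero eigenvalues are set aside; what remains of S is
   still a top set. *)
pose Sp := [pred l | S l && (0 < d 0 l)].
have key i r : \sum_(l | Sp l) p i 0 r * c i r l * (f (d 0 l) / d 0 l) <=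
    f (p i 0 r) * \sum_(l | Sp l) c i r l.
  have [pz|pn0] := eqVneq (p i 0 r) 0.
    rewrite big1 => [|l _]; last by rewrite pz !mul0r.
    by rewrite mulr_ge0 ?f0 ?sumr_ge0.
  have ppos : 0 < p i 0 r by rewrite lt_neqAle eq_sym pn0 p0.
  apply: concave_top_weights => //.
  - move=> l dl0; have := pD i r (row l U).
    rewrite -/(c i r l) (qf_eig_row l eD).
    rewrite dl0 pmulr_rle0 // => cle; apply/eqP; rewrite eq_le cle; exact: c0.
  - exact: pG.
  - by move=> l /andP[].
  - move=> l k /andP[Sl dl]; rewrite negb_and => /orP[/(Stop _ _ Sl)//|].
    by rewrite -leNgt => /le_trans; apply; apply: ltW.
have pos_part : \sum_(l | Sp l) f (d 0 l) <=
    \sum_(l | Sp l) qf (\sum_i fun_mx f (P i)) (row l U).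
  have -> : \sum_(l | Sp l) f (d 0 l) =
      \sum_i \sum_r \sum_(l | Sp l) p i 0 r * c i r l * (f (d 0 l) / d 0 l).
    under [RHS]eq_bigr do rewrite exchange_big.
    rewrite exchange_big /=; apply: eq_bigr => l /andP[_ dl].
    under eq_bigr do rewrite -mulr_suml.
    by rewrite -mulr_suml -dE mulrC divfK // gt_eqF.
  rewrite (eq_bigr _ (fun l _ => fE l)) [X in _ <= X]exchange_big /=.
  apply: ler_sum => i _; rewrite [X in _ <= X]exchange_big /=.
  by apply: ler_sum => r _; rewrite -mulr_sumr.
rewrite (bigID (fun l => 0 < d 0 l)) /=.
rewrite [X in _ <= X](bigID (fun l => 0 < d 0 l)) /=.
apply: lerD pos_part _; apply: ler_sum => l /andP[_]; rewrite -leNgt => dl0.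
have -> : d 0 l = 0 by apply/eqP; rewrite eq_le dl0 d0.
(* At a zero eigenvalue the single index [i0] suffices: its coefficients over r sum to 1 and f(p) >=
   f(0) for each of them. *)
rewrite fE (bigD1 i0) //= -[X in X <= _]addr0; apply: lerD; last first.
  apply: sumr_ge0 => i _; apply: sumr_ge0 => r _.
  by rewrite mulr_ge0 ?f0.
have -> : f 0 = \sum_r f 0 * c i0 r l.
  rewrite -mulr_sumr -[LHS]mulr1; congr (_ * _).
  exact: esym (etrans (sqn_unitary _ (Vu i0)) (sqn_unitary_row l Uu)).
by apply: ler_sum => r _; rewrite ler_wpM2r // fhomo.
Qed.

(** * Block matrices and the bound of A by D *)

Lemma sum_Rank (R : nmodType) (m n : nat) (P : pred 'I_(\sum_(i < m) n))
    (F : 'I_(\sum_(i < m) n) -> R) :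
  \sum_(s | P s) F s =
  \sum_(i < m) \sum_(l < n | P (tagnat.Rank (p_ := fun=> n) i l))
    F (tagnat.Rank (p_ := fun=> n) i l).
Proof.
rewrite sig_big_dep /= [LHS](reindex _ (onW_bij _ tagnat.rank_bij)) /=.
by apply: eq_big => p; rewrite tagnat.rankE.
Qed.

Lemma mxdiag_mul (R : pzSemiRingType) (m n : nat) (A B : 'I_m -> 'M[R]_n) :
  (\mxdiag_i A i) *m (\mxdiag_i B i) = \mxdiag_i (A i *m B i).
Proof.
rewrite {1}/mxdiag mul_mxblock_mxdiag; apply: eq_mxblock => i j.
by case: eqVneq => [->|_]; rewrite ?conform_mx_id ?mul0mx.
Qed.

Lemma trmxC_mxdiag (R : realType) (m n : nat) (A : 'I_m -> 'M[R[i]]_n) :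
  (\mxdiag_i A i)^t* = \mxdiag_i (A i)^t*.
Proof.
rewrite tr_mxdiag; apply/matrixP => s t; rewrite !mxE.
case: eqVneq => [->|_]; last by rewrite !mxE conjC0.
by rewrite !conform_mx_id !mxE.
Qed.

Lemma trmxC_mxrow (R : realType) (m n k : nat) (x : 'I_m -> 'M[R[i]]_(k, n)) :
  (\mxrow_i x i)^t* = \mxcol_i (x i)^t*.
Proof. by apply/matrixP => s t; rewrite !mxE. Qed.

Lemma eigdec_mxdiag (R : realType) (m n : nat) (P U : 'I_m -> 'M[R[i]]_n)
    (d : 'I_m -> 'rV[R]_n) :
  (forall i, eigdec (P i) (U i) (d i)) ->
  eigdec (\mxdiag_i P i) (\mxdiag_i U i) (\mxrow_i d i).
Proof.
move=> eP; split.
  apply/unitarymxP; rewrite trmxC_mxdiag mxdiag_mul -mxdiagZ.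
  by apply: eq_mxdiag => i; case: (eP i) => /unitarymxP.
have -> : map_mx (real_complex R) (\mxrow_i d i) =
    \mxrow_i map_mx (real_complex R) (d i).
  by apply/matrixP => s t; rewrite !mxE.
rewrite diag_mxrow trmxC_mxdiag !mxdiag_mul.
by apply: eq_mxdiag => i; case: (eP i).
Qed.

Lemma mxrow_Rank (T : Type) (m n k : nat) (x : 'I_m -> 'M[T]_(k, n)) r i l :
  (\mxrow_i x i) r (tagnat.Rank (p_ := fun=> n) i l) = x i r l.
Proof. by rewrite -[in RHS](mxrowK x i) [RHS]mxE. Qed.

Lemma qf_mxdiag (R : realType) (m n : nat) (P : 'I_m -> 'M[R[i]]_n)
    (x : 'I_m -> 'rV[R[i]]_n) :
  qf (\mxdiag_i P i) (\mxrow_i x i) = \sum_i qf (P i) (x i).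
Proof.
rewrite /qf mul_mxrow_mxdiag trmxC_mxrow mul_mxrow_mxcol summxE.
by rewrite raddf_sum.
Qed.

Lemma qf_mxblock (R : realType) (m n : nat) (B : 'I_m -> 'I_m -> 'M[R[i]]_n)
    (x : 'I_m -> 'rV[R[i]]_n) :
  qf (\mxblock_(i, j) B i j) (\mxrow_i x i) =
  \sum_i \sum_j complex.Re ((x i *m B i j *m (x j)^t*) 0 0).
Proof.
rewrite /qf mul_mxrow_mxblock trmxC_mxrow mul_mxrow_mxcol summxE raddf_sum.
rewrite exchange_big /=; apply: eq_bigr => j _.
by rewrite mulmx_suml summxE raddf_sum.
Qed.

(* |A_ij^*| = |A_ji| because A is Hermitian, so both halves of the estimate of
   a block are terms of D. *)
Lemma qf_herm_le_diag_abs (R : realType) (m n : nat)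
    (A : 'M[R[i]]_(\sum_(i < m) n)) (x : 'rV[R[i]]_(\sum_(i < m) n)) :
  A \is hermsymmx ->
  `|qf A x| <= qf (\mxdiag_j \sum_i abs_mx (submxblock A i j)) x.
Proof.
move=> /hermsymP hA; rewrite -{1}(submxblockK A) -(submxrowK x).
rewrite qf_mxblock qf_mxdiag.
have blockC i j : (submxblock A i j)^t* = submxblock A j i.
  by rewrite -[in RHS]hA; apply/matrixP => s t; rewrite !mxE.
apply: (@le_trans _ _ (\sum_i \sum_j 2^-1 *
    (qf (abs_mx (submxblock A j i)) (submxrow x i) +
     qf (abs_mx (submxblock A i j)) (submxrow x j)))).
  apply: le_trans (ler_norm_sum _ _ _) _; apply: ler_sum => i _.
  apply: le_trans (ler_norm_sum _ _ _) _; apply: ler_sum => j _.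
  by rewrite -[submxblock A j i]blockC; apply: Re_form_le_abs.
under eq_bigr do rewrite -mulr_sumr big_split.
rewrite -mulr_sumr big_split /=.
set T := \sum_j qf (\sum_i _) _.
have T1 : \sum_i \sum_j qf (abs_mx (submxblock A j i)) (submxrow x i) = T.
  by apply: eq_bigr => i _; rewrite qf_sum.
have T2 : \sum_i \sum_j qf (abs_mx (submxblock A i j)) (submxrow x j) = T.
  by rewrite exchange_big.
by rewrite T1 T2; lra.
Qed.

(** * Merging the diagonal blocks into one n x n matrix *)

(** Bessel's inequality for the orthonormal rows of [B]: the residual h - y B has squared norm
    [sqn h - sqn y]. *)
Lemma isometry_sqn_le (R : realType) k n (B : 'M[R[i]]_(k, n))
    (h : 'rV[R[i]]_n) : B \is unitarymx -> sqn (h *m B^t*) <= sqn h.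
Proof.
move=> Bu; pose y := h *m B^t*.
have e1 : (h - y *m B) *m (h - y *m B)^t* = h *m h^t* - y *m y^t*.
  rewrite linearB /= map_mxB mulmxBl !mulmxBr mulmxC.
  have -> : h *m (B^t* *m y^t*) = y *m y^t* by rewrite mulmxA.
  have -> : y *m B *m (B^t* *m y^t*) = y *m y^t* by rewrite mulmxA mulmxtVK.
  have -> : y *m B *m h^t* = y *m y^t*.
    by rewrite {3}/y mulmxC trmxCK mulmxA.
  by rewrite subrr subr0.
have := sqn_ge0 (h - y *m B); suff -> : sqn (h - y *m B) = sqn h - sqn y.
  by rewrite subr_ge0.
apply: (@complexI R); rewrite rmorphB /= -!mulmxC_sqn e1.
by rewrite [LHS]mxE [X in _ + X]mxE.
Qed.

Lemma nsq_row_swap (R : realType) k n m (B : 'M[R[i]]_(k, n))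
    (H : 'M[R[i]]_(m, n)) b l :
  nsq ((row b B *m H^t*) 0 l) = nsq ((row l H *m B^t*) 0 b).
Proof.
rewrite -[RHS]nsq_conj -mxCE mulmxC trmxCK; congr nsq.
by rewrite !mxE; apply: eq_bigr => s _; rewrite !mxE.
Qed.

(* B is an orthonormal basis of the span of all the chosen rows.  Its projection
   dominates, for every j, the projection onto the rows chosen from U j, and
   its trace is at most the total number of chosen rows. *)
Lemma sum_top_blocks_le (R : realType) (m n k : nat)
    (Y : 'I_m -> 'M[R[i]]_n) (U : 'I_m -> 'M[R[i]]_n) (S : 'I_m -> pred 'I_n)
    (H : 'M[R[i]]_n) (eta : 'rV[R]_n) :
  (forall j, psd (Y j)) -> (forall j, U j \is unitarymx) ->
  eigdec (\sum_j Y j) H eta ->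
  (\sum_j \sum_(l | S j l) 1 <= k)%N ->
  exists w : 'I_n -> R, [/\ forall l, 0 <= w l <= 1, \sum_l w l <= k%:R &
    \sum_j \sum_(l | S j l) qf (Y j) (row l (U j)) <= \sum_l w l * eta 0 l].
Proof.
move=> Ypsd Uu eH Sk.
have [K [y eY]] := herm_eigdec_fam (fun j => (Ypsd j).1).
have y0 j r : 0 <= y j 0 r := psd_eig_ge0 r (Ypsd j) (eY j).
have Hu : H \is unitarymx by case: eH.
pose Gj j := (\sum_(l | S j l) <<row l (U j)>>)%MS.
pose G := (\sum_j <<Gj j>>)%MS.
have rkG : (\rank G <= k)%N.
  apply: leq_trans Sk; apply: leq_trans (mxrank_sum_leqif _).1 _.
  apply: leq_sum => j _; rewrite /= genmxE.
  apply: leq_trans (mxrank_sum_leqif _).1 _; apply: leq_sum => l _ /=.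
  by rewrite genmxE rank_leq_row.
pose B := schmidt (row_base G).
have Bu : B \is unitarymx by apply: schmidt_unitarymx; apply: rank_leq_col.
have rowB j l : S j l -> row l (U j) *m B^t* *m B = row l (U j).
  move=> Sl; have : (row l (U j) <= B)%MS.
    apply: submx_trans (schmidt_sub _); rewrite eq_row_base.
    apply: (sumsmx_sup j) => //; rewrite genmxE.
    by apply: (sumsmx_sup l) => //; rewrite genmxE.
  by move=> /submxP[c ->]; rewrite mulmxtVK.
(* The diagonal of the projection onto the row span of [B], in the eigenbasis [H]: entries are at
   most 1 by Bessel, and the trace is the rank. *)
exists (fun l => \sum_b nsq ((row b B *m H^t*) 0 l)); split.
- move=> l; rewrite sumr_ge0 /= => [|b _]; last exact: nsq_ge0.
  rewrite (eq_bigr _ (fun b _ => nsq_row_swap B H b l)).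
  rewrite -[X in _ <= X](sqn_unitary_row l Hu).
  exact: isometry_sqn_le.
- rewrite exchange_big /=.
  apply: (@le_trans _ _ (\sum_(b < \rank G) 1)); last first.
    by rewrite sumr_const card_ord ler_nat.
  apply: ler_sum => b _; rewrite -[X in X <= _]/(sqn (row b B *m H^t*)).
  by rewrite (sqn_unitary _ Hu) (sqn_unitary_row b Bu).
have -> : \sum_l (\sum_b nsq ((row b B *m H^t*) 0 l)) * eta 0 l =
    \sum_j \sum_b qf (Y j) (row b B).
  rewrite [RHS]exchange_big /=.
  under [RHS]eq_bigr do rewrite -qf_sum (qf_eig _ eH).
  rewrite [RHS]exchange_big /=; apply: eq_bigr => l _.
  by rewrite mulrC mulr_sumr.
apply: ler_sum => j _.
under eq_bigr do rewrite (qf_eig _ (eY j)).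
under [X in _ <= X]eq_bigr do rewrite (qf_eig _ (eY j)).
rewrite exchange_big [X in _ <= X]exchange_big /=; apply: ler_sum => r _.
rewrite -!mulr_sumr ler_wpM2l //.
pose z := row r (K j) *m B^t*.
have -> : \sum_(b < \rank G) nsq ((row b B *m (K j)^t*) 0 r) = sqn z.
  by apply: eq_bigr => b _; rewrite nsq_row_swap.
(* The projection of the eigenvector is expanded in the whole basis [U j]. For l in [S j] the basis
   vector lies in the span of [B], so projecting does not change that coefficient; the others are
   dropped. *)
have -> : sqn z = sqn (z *m B *m (U j)^t*).
  by rewrite (sqn_unitary _ (Uu j)) (sqn_isometry _ Bu).
rewrite [X in _ <= X](bigID (S j)) /= -[X in X <= _]addr0.
apply: lerD; last first.
  by apply: sumr_ge0 => l _; apply: nsq_ge0.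
apply: ler_sum => l Sl; rewrite nsq_row_swap.
have entry (h : 'rV[R[i]]_n) :
    (h *m (U j)^t*) 0 l = (h *m (row l (U j))^t*) 0 0.
  by rewrite !mxE; apply: eq_bigr => s _; rewrite !mxE.
rewrite !entry -{1}(rowB j l Sl) (mulmxC (_ *m _) B) (mulmxC (row _ _)) trmxCK.
by rewrite !mulmxA.
Qed.

(** * Symmetric norms and padding *)

Lemma symnorm_eigdec (R : realType) k (N : 'M[R[i]]_k -> R) (P U : 'M[R[i]]_k)
    (d : 'rV[R]_k) : symmetric_norm N -> eigdec P U d ->
  N P = N (diag_mx (map_mx (real_complex R) d)).
Proof.
move=> hN [Uu ->]; have U'u : U^t* \is unitarymx by rewrite trmxC_unitary.
exact: symnorm_unitary hN _ _ _ U'u Uu.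
Qed.

Lemma eigdec_diag (R : realType) k (d : 'rV[R]_k) :
  eigdec (diag_mx (map_mx (real_complex R) d)) 1%:M d.
Proof.
split; first by apply/unitarymxP; rewrite trmx1 map_mx1 mulmx1.
by rewrite trmx1 map_mx1 mulmx1 mul1mx.
Qed.

Lemma normc_real (R : realType) (a : R) :
  0 <= a -> ComplexField.Normc.normc a%:C = a.
Proof. by move=> a0; rewrite /= expr0n addr0 sqrtr_sqr ger0_norm. Qed.

Lemma symnorm_comb (R : realType) k (N : 'M[R[i]]_k -> R) (x y : 'rV[R]_k)
    (c : R) : symmetric_norm N -> 0 <= c <= 1 ->
  N (diag_mx (map_mx (real_complex R)
      (\row_s ((1 - c) * x 0 s + c * y 0 s)))) <=
  (1 - c) * N (diag_mx (map_mx (real_complex R) x)) +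
  c * N (diag_mx (map_mx (real_complex R) y)).
Proof.
move=> hN /andP[c0 c1].
have -> : map_mx (real_complex R) (\row_s ((1 - c) * x 0 s + c * y 0 s)) =
    (1 - c)%:C *: map_mx (real_complex R) x + c%:C *: map_mx (real_complex R) y.
  by apply/rowP => s; rewrite !mxE rmorphD !rmorphM.
rewrite linearD !linearZ /=; apply: le_trans (symnormD hN _ _) _.
by rewrite !(symnormZ hN) !normc_real // subr_ge0.
Qed.

(** Ky Fan dominance for diagonal matrices. N is convex and unchanged when entries are permuted or
    one changes sign; a T-transform averages a vector with a permuted copy, and lowering an entry
    averages it with its sign flip. *)
Lemma symnorm_weak_majorization (R : realType) k (N : 'M[R[i]]_k -> R)
    (x y : 'rV[R]_k) :
  symmetric_norm N -> (forall s, 0 <= x 0 s) ->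
  (forall i j : 'I_k, (i <= j)%N -> x 0 j <= x 0 i) ->
  (forall j, (j <= k)%N ->
    \sum_(s < k | (s < j)%N) x 0 s <= \sum_(s < k | (s < j)%N) y 0 s) ->
  N (diag_mx (map_mx (real_complex R) x)) <=
  N (diag_mx (map_mx (real_complex R) y)).
Proof.
move=> hN x0 xdec.
apply: (weak_majorization_le
  (Phi := fun z => N (diag_mx (map_mx (real_complex R) z)))) => //.
- move=> z i l c c01; have E : N (diag_mx (map_mx (real_complex R) z)) =
      N (diag_mx (map_mx (real_complex R) (col_perm (tperm i l) z))).
    exact: symnorm_eigdec hN (eigdec_perm _ (eigdec_diag z)).
  have := symnorm_comb z (col_perm (tperm i l) z) hN c01.
  rewrite -E -mulrDl subrK mul1r; apply: le_trans; rewrite le_eqVlt; apply/orP.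
  left; apply/eqP; congr (N (diag_mx (map_mx _ _))).
  by apply/rowP => s; rewrite !mxE.
move=> z l xz; have [z0|zn0] := eqVneq (z 0 l) 0.
  rewrite le_eqVlt; apply/orP; left; apply/eqP.
  congr (N (diag_mx (map_mx _ _))).
  apply/rowP => s; rewrite !mxE; case: eqP => // ->.
  by apply/eqP; rewrite eq_le xz z0 x0.
have zpos : 0 < z 0 l by rewrite lt_neqAle eq_sym zn0 (le_trans (x0 l)).
pose z' := \row_s (if s == l then - z 0 s else z 0 s).
have E : N (diag_mx (map_mx (real_complex R) z')) =
    N (diag_mx (map_mx (real_complex R) z)).
  pose e : 'rV[R[i]]_k := \row_s (if s == l then -1 else 1).
  have eu : diag_mx e \is unitarymx.
    apply/unitarymxP; rewrite tr_diag_mx map_diag_mx mulmx_diag.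
    rewrite -diag_const_mx; congr diag_mx; apply/rowP => s; rewrite !mxE.
    by case: eqP => _; rewrite ?rmorphN rmorph1 ?mulrNN mulr1.
  have onu : (1%:M : 'M[R[i]]_k) \is unitarymx by case: (eigdec_diag x).
  rewrite -[RHS](symnorm_unitary hN _ eu onu) mulmx1 mulmx_diag; congr N.
  congr diag_mx; apply/rowP => s; rewrite !mxE.
  by case: eqP => _; rewrite ?mulN1r ?mul1r ?rmorphN.
(* The solution of (1 - c) z_l - c z_l = x_l. *)
pose c := (1 - x 0 l / z 0 l) / 2.
have xz1 : x 0 l / z 0 l <= 1 by rewrite ler_pdivrMr ?mul1r.
have xz0 : 0 <= x 0 l / z 0 l by rewrite divr_ge0 // ltW.
have c01 : 0 <= c <= 1 by rewrite /c; lra.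
have := symnorm_comb z z' hN c01.
rewrite E -mulrDl subrK mul1r; apply: le_trans; rewrite le_eqVlt; apply/orP.
left; apply/eqP; congr (N (diag_mx (map_mx _ _))).
apply/rowP => s; rewrite !mxE.
case: eqP => [->|_]; last by ring.
by rewrite /c; field.
Qed.

Lemma pad_mxE (R : realType) m n (Y : 'M[R[i]]_n) :
  pad_mx m Y = \mxdiag_(i < m) (if i == 0%N :> nat then Y else 0).
Proof.
rewrite /pad_mx /mxdiag; apply: eq_mxblock => i j.
case: (eqVneq i j) => [->|ij].
  by rewrite conform_mx_id andbb.
case: andP => // -[/eqP i0 /eqP j0].
by move: ij; rewrite -(inj_eq val_inj) /= i0 j0 eqxx.
Qed.

Definition pad_row (R : nmodType) (m n : nat) (x : 'rV[R]_n) :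
    'rV[R]_(\sum_(i < m) n) :=
  \mxrow_(i < m) (if i == 0%N :> nat then x else 0).

Lemma pad_row_ind (R : nmodType) (m n : nat) (Q : R -> Prop) (x : 'rV[R]_n) :
  Q 0 -> (forall l, Q (x 0 l)) -> forall s, Q (pad_row m x 0 s).
Proof. by move=> Q0 Qx s; rewrite mxE; case: ifP => _; rewrite ?mxE. Qed.

Lemma sum_pad_row (R : nmodType) (m n : nat) (F : R -> R -> R)
    (x y : 'rV[R]_n) :
  (0 < m)%N -> F 0 0 = 0 ->
  \sum_s F (pad_row m x 0 s) (pad_row m y 0 s) = \sum_l F (x 0 l) (y 0 l).
Proof.
move=> m0 F0; rewrite sum_Rank (bigD1 (Ordinal m0)) //= [X in _ + X]big1.
  by rewrite addr0; apply: eq_bigr => l _; rewrite !mxrow_Rank.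
move=> i i0; rewrite big1 // => l _; rewrite !mxrow_Rank.
by rewrite -val_eqE /= in i0; rewrite (negPf i0) !mxE.
Qed.

Lemma eigdec_pad (R : realType) m n (Y H : 'M[R[i]]_n) (eta : 'rV[R]_n) :
  eigdec Y H eta ->
  eigdec (pad_mx m Y)
    (\mxdiag_(i < m) (if i == 0%N :> nat then H else 1%:M)) (pad_row m eta).
Proof.
move=> eY; rewrite pad_mxE.
have e i : eigdec (if i == 0%N :> nat then Y else 0)
    (if i == 0%N :> nat then H else 1%:M) (if i == 0%N :> nat then eta else 0).
  case: eqP => _; first exact: eY.
  have := eigdec_diag (0 : 'rV[R]_n); rewrite map_mx0 linear0; exact.
exact: (eigdec_mxdiag (m := m) (fun i : 'I_m => e i)).
Qed.

Lemma sum_fun_abs_eig_le (R : realType) (f : R -> R) n (A U D V : 'M[R[i]]_n)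
    (a d : 'rV[R]_n) :
  (forall s t, 0 <= s -> s <= t -> f s <= f t) -> e_convex f ->
  eigdec A U a -> eigdec D V d ->
  (forall i j : 'I_n, (i <= j)%N -> `|a 0 j| <= `|a 0 i|) ->
  (forall i j : 'I_n, (i <= j)%N -> d 0 j <= d 0 i) ->
  (forall x, `|qf A x| <= qf D x) -> forall k, (k <= n)%N ->
  \sum_(s < n | (s < k)%N) f `|a 0 s| <= \sum_(s < n | (s < k)%N) f (d 0 s).
Proof.
move=> fhomo ef eA eD adec ddec AD.
have a0 s : 0 <= `|a 0 s| by [].
have d0 s : 0 <= d 0 s by rewrite -(qf_eig_row s eD) (le_trans _ (AD _)).
apply: (weak_log_majorization_sum_le fhomo ef a0 d0 adec) => k kn apos.
by apply: (prod_abs_eig_le eA eD ddec AD kn) => s /apos; rewrite normr_gt0.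
Qed.

(** Each of the top k eigenvectors of the block diagonal D lies in a single block; [S j] collects
    those of block j, k in all. Subadditivity is applied inside each block, and the blocks are then
    merged under one family of weights. *)
Lemma sum_concave_block_le (R : realType) (f : R -> R) (m n : nat)
    (P : 'I_m -> 'I_m -> 'M[R[i]]_n) (V : 'I_m -> 'M[R[i]]_n)
    (d : 'I_m -> 'rV[R]_n) (H : 'M[R[i]]_n) (eta : 'rV[R]_n)
    (t : 'S_(\sum_(i < m) n)) (k : nat) :
  (forall x, 0 <= x -> 0 <= f x) -> concave_on_nonneg f ->
  (forall i j, psd (P i j)) -> (forall j, eigdec (\sum_i P i j) (V j) (d j)) ->
  eigdec (\sum_j \sum_i fun_mx f (P i j)) H eta ->
  (forall r s : 'I_(\sum_(i < m) n), (r <= s)%N ->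
    (\mxrow_j d j) 0 (t s) <= (\mxrow_j d j) 0 (t r)) ->
  (k <= \sum_(i < m) n)%N ->
  exists w : 'I_n -> R, [/\ forall l, 0 <= w l <= 1, \sum_l w l <= k%:R &
    \sum_(s < \sum_(i < m) n | (s < k)%N) f ((\mxrow_j d j) 0 (t s)) <=
    \sum_l w l * eta 0 l].
Proof.
move=> f0 cf P0 eD eH tdec kM.
pose rk j l := tagnat.Rank (p_ := fun=> n) j l : 'I_(\sum_(i < m) n).
have dE j l : (\mxrow_j d j) 0 (rk j l) = d j 0 l by apply: mxrow_Rank.
pose S j := [pred l : 'I_n | ((t^-1)%g (rk j l) < k)%N].
have cardS : (\sum_j \sum_(l | S j l) 1 <= k)%N.
  rewrite -(sum_Rank (fun s => ((t^-1)%g s < k)%N) (fun=> 1%N)).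
  rewrite (reindex_inj (@perm_inj _ t)) /=.
  rewrite (eq_bigl (fun s : 'I_(\sum_(i < m) n) => (s < k)%N)) => [|s].
    by rewrite (big_ord_narrow kM) sum1_card card_ord.
  by rewrite permK.
have Y0 j : psd (\sum_i fun_mx f (P i j)).
  by apply: psd_sum => i; apply: psd_fun (P0 i j).
have [w [w01 wk le_w]] := sum_top_blocks_le Y0 (fun j => (eD j).1) eH cardS.
exists w; split=> //; apply: le_trans le_w.
rewrite (reindex_inj (@perm_inj _ (t^-1)%g)) sum_Rank.
apply: ler_sum => j _.
rewrite (eq_bigr (fun l => f (d j 0 l))) => [|l _]; last by rewrite permKV dE.
apply: (concave_top_eig_le j f0 cf (fun i => P0 i j) (eD j)) => l l' /= lk.
rewrite -leqNgt => /(leq_trans (ltnW lk))/tdec.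
by rewrite !permKV !dE.
Qed.

(** Padding adds only zero eigenvalues, to which weight 0 is given; this also covers k > n. *)
Lemma sum_weights_le_pad (R : realType) (m n : nat) (w : 'I_n -> R)
    (eta : 'rV[R]_n) (t : 'S_(\sum_(i < m) n)) (k : nat) :
  (0 < m)%N -> (forall l, 0 <= w l <= 1) -> \sum_l w l <= k%:R ->
  (forall l, 0 <= eta 0 l) ->
  (forall r s : 'I_(\sum_(i < m) n), (r <= s)%N ->
    pad_row m eta 0 (t s) <= pad_row m eta 0 (t r)) ->
  \sum_l w l * eta 0 l <=
  \sum_(s < \sum_(i < m) n | (s < k)%N) pad_row m eta 0 (t s).
Proof.
move=> m0 w01 wk eta0 tdec; pose wr := \row_l w l.
have wrE l : wr 0 l = w l by rewrite mxE.
have -> : \sum_l w l * eta 0 l = \sum_s pad_row m wr 0 s * pad_row m eta 0 s.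
  rewrite (sum_pad_row (F := *%R) wr eta m0 (mulr0 0)).
  by apply: eq_bigr => l _; rewrite wrE.
apply: sum_weights_le_top_perm tdec _ _ _.
- exact: (pad_row_ind (Q := fun t => 0 <= t) (lexx 0) eta0).
- apply: (pad_row_ind (Q := fun t => 0 <= t <= 1)) => [|l]; last by rewrite wrE.
  by rewrite lexx ler01.
rewrite (sum_pad_row (F := fun t _ => t) wr 0 m0 (erefl 0)).
by rewrite (eq_bigr _ (fun l _ => wrE l)).
Qed.

Theorem theorem2p5 (R : realType) (m n : nat) (hm : (0 < m)%N) (hn : (0 < n)%N)
  (A : 'M[R[i]]_(\sum_(i < m) n)) (hA : A \is hermsymmx)
  (f : R -> R) (f_ge0 : forall x : R, 0 <= x -> 0 <= f x)
  (f_concave : concave_on_nonneg f) (f_econvex : e_convex f)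
  (N : 'M[R[i]]_(\sum_(i < m) n) -> R) (hN : symmetric_norm N) :
  N (fun_mx f (abs_mx A)) <=
  N (pad_mx m (\sum_(i < m) \sum_(j < m) fun_mx f (abs_mx (submxblock A i j)))).
Proof.
have fhomo := concave_ge0_homo f_ge0 f_concave.
have [U [a [eA adec]]] := herm_eigdec_sorted Num.norm hA.
pose P i j := abs_mx (submxblock A i j).
have P0 i j : psd (P i j) by apply: psd_abs.
have [V [d eD]] := herm_eigdec_fam (fun j => (psd_sum (P0 ^~ j)).1).
have [t tdec] := perm_nonincreasing (fun s => (\mxrow_j d j) 0 s).
have eDt := eigdec_perm t (eigdec_mxdiag eD).
have Y0 : psd (\sum_j \sum_i fun_mx f (P i j)).
  by do 2 apply: psd_sum => ?; apply: psd_fun (P0 _ _).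
have [H [eta eH]] : exists H eta, eigdec (\sum_j \sum_i fun_mx f (P i j)) H eta.
  by do 2 eexists; exact: herm_eigdec Y0.1.
have eta0 l := psd_eig_ge0 l Y0 eH.
have [u udec] := perm_nonincreasing (fun s => pad_row m eta 0 s).
(* The sum over j becomes the outer one, so that the inner sums over i match the diagonal blocks of
   D. *)
rewrite exchange_big /= (symnorm_eigdec hN (eigdec_fun f (eigdec_abs_herm eA))).
rewrite [X in _ <= X](symnorm_eigdec hN (eigdec_perm u (eigdec_pad m eH))).
apply: (symnorm_weak_majorization hN).
- by move=> s; rewrite !mxE f_ge0.
- by move=> i j /adec ij; rewrite !mxE fhomo.
move=> k kM.
(* For each k, the weighted sum of [eta] separates the Ky Fan sum of f(D) from that of the padded
   right-hand side. *)
have [w [w01 wk le_w]] := sum_concave_block_le f_ge0 f_concave P0 eD eH tdec kM.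
have step1 := sum_fun_abs_eig_le fhomo f_econvex eA eDt adec.
rewrite (eq_bigr (fun s => f `|a 0 s|)) => [|s _]; last by rewrite !mxE.
rewrite [X in _ <= X](eq_bigr (fun s => pad_row m eta 0 (u s))); last first.
  by move=> s _; rewrite mxE.
apply: le_trans (sum_weights_le_pad hm w01 wk eta0 udec).
apply: le_trans le_w.
have tE s : (col_perm t (\mxrow_j d j)) 0 s = (\mxrow_j d j) 0 (t s).
  by rewrite mxE.
rewrite -(eq_bigr _ (fun s _ => congr1 f (tE s))).
apply: step1 => //.
- by move=> r s rs; rewrite !tE tdec.
- by move=> x; apply: qf_herm_le_diag_abs.
Qed.
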